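(* The norm of the Hilbert matrix operator $\mathcal{H}$ acting from the Hardy space $H^1$ into the logarithmically weighted Hardy space $H^1_{\log}$ satisfies the upper bound $$\|\mathcal{H}\|_{H^1\to H^1_{\log}}\le 2\pi\log 2.$$
   Context: Let $\mathbb{D}$ be the open unit disk of $\mathbb{C}$ and $H(\mathbb{D})$ the set of all analytic functions in $\mathbb{D}$. For $f(z)=\sum_{k=0}^\infty a_kz^k\in H(\mathbb{D})$, the Hilbert matrix operator is defined by $$\mathcal{H}f(z)=\sum_{n=0}^\infty\left(\sum_{k=0}^\infty\frac{a_k}{n+k+1}\right)z^n,$$ whenever the right-hand side makes sense (the inner series converging as ordinary limits of partial sums) and defines an analytic function in $\mathbb{D}$. For $f\in H(\mathbb{D})$ and $0\le r<1$ put $M_1(r,f)=\frac{1}{2\pi}\int_0^{2\pi}|f(re^{it})|\,dt$. The Hardy space $H^1$ consists of all $f\in H(\mathbb{D})$ with $\|f\|_{H^1}=\sup_{0\le r<1}M_1(r,f)<\infty$. The logarithmically weighted Hardy space $H^1_{\log}$ consists of all $f\in H(\mathbb{D})$ with $$\|f\|_{H^1_{\log}}=\sup_{0\le r<1}\left(\log\frac{e}{(1-r)^2}\right)^{-1}M_1(r,f)<\infty.$$ The operator norm is $\|\mathcal{H}\|_{H^1\to H^1_{\log}}=\sup\{\|\mathcal{H}f\|_{H^1_{\log}}/\|f\|_{H^1}: 0\ne f\in H^1\}$. *)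

(* Defs.v *)
From Stdlib Require Import Reals.
From Coquelicot Require Import Coquelicot.
Open Scope R_scope.

Definition in_disk (z : C) : Prop := Cmod z < 1.

(* Functions on the disk are total functions C -> C whose values outside the
   disk are never used. *)
Definition analytic_on_disk (f : C -> C) : Prop :=
  forall w : C, in_disk w ->
    exists (a : nat -> C) (delta : R), 0 < delta /\
      forall z : C, Cmod (z - w)%C < delta -> is_pseries a (z - w)%C (f z).

Definition power_series_on_disk (a : nat -> C) (f : C -> C) : Prop :=
  forall z : C, in_disk z -> is_pseries a z (f z).

(* The graph of the (a priori only partially defined) operator: [g] is
   determined by [f] on the disk, and [exists g, hilbert f g] says that the
   operator makes sense at [f]. *)
Definition hilbert (f g : C -> C) : Prop :=
  exists a b : nat -> C,
    power_series_on_disk a f /\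
    (forall n : nat,
       is_series (fun k : nat => (a k / RtoC (INR (n + k + 1)))%C) (b n)) /\
    power_series_on_disk b g /\
    analytic_on_disk g.

Definition M1 (r : R) (f : C -> C) : R :=
  / (2 * PI) * RInt (fun t : R => Cmod (f (r * cos t, r * sin t))) 0 (2 * PI).

Definition H1_norm (f : C -> C) : Rbar :=
  Lub_Rbar (fun x : R => exists r : R, 0 <= r < 1 /\ x = M1 r f).

Definition H1 (f : C -> C) : Prop :=
  analytic_on_disk f /\ Rbar_lt (H1_norm f) p_infty.

Definition H1log_norm (f : C -> C) : Rbar :=
  Lub_Rbar (fun x : R => exists r : R, 0 <= r < 1 /\
    x = / ln (exp 1 / (1 - r) ^ 2) * M1 r f).

Definition H1log (f : C -> C) : Prop :=
  analytic_on_disk f /\ Rbar_lt (H1log_norm f) p_infty.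

Definition not_identically_zero (f : C -> C) : Prop :=
  exists z : C, in_disk z /\ f z <> RtoC 0.

(* For [f] in H1 not identically zero on the disk, [H1_norm f] is finite and positive, so
   the conventions of [Rbar_div] at 0 and infinity play no role. *)
Definition hilbert_norm_H1_H1log : Rbar :=
  Rbar_lub (fun q : Rbar => exists f g : C -> C,
    H1 f /\ not_identically_zero f /\ hilbert f g /\
    q = Rbar_div (H1log_norm g) (H1_norm f)).

(* Main.v *)
Require Import Defs.
From Stdlib Require Import Reals Lra Lia Psatz Classical.
From Coquelicot Require Import Coquelicot.
Open Scope R_scope.

(** The whole statement rests on one Fourier integral:
    [1/m = (1/2pi) * int_0^{2pi} -i (pi - t) e^{imt} dt] for every integer
    [m >= 1].  Write [f(z) = sum a_k z^k].  Taking [m = n + k + 1] and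
    integrating term by term on the circle of radius [rho < 1],

      [sum_k a_k rho^k / (n+k+1)
         = (1/2pi) int f(rho e^{it}) (-i)(pi - t) e^{i(n+1)t} dt],

    and multiplying by [z^n] and summing over [n] turns the image of
    [f(rho .)] under the Hilbert matrix into the integral of
    [f(rho e^{it}) (-i)(pi - t) e^{it} / (1 - z e^{it})].  Since
    [|pi - t| <= pi], averaging over [|z| = r] and exchanging the two integrals
    bounds its mean by [pi * ||f||] times the mean of [1/|1 - r e^{it}|].
    The latter is at most [1 + 2 log (1/(1-r)) = log (e/(1-r)^2)]: its derivative
    in [r] is at most the mean of [1/|1 - r e^{it}|^2], a Poisson integral equal
    to [1/(1-r^2)].  Letting [rho] tend to 1 ([abel_image_approx]) gives
    [M1(r, Hf) <= pi ||f|| log (e/(1-r)^2)] ([M1_hilbert_bound]), and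
    [pi <= 2 pi log 2] because [log 2 > 1/2].

    The operator must also be shown to make sense on all of [H^1], that is, the
    series [sum_k a_k/(n+k+1)] must converge in the ordinary sense
    ([hilbert_coef_conv]).  Frequencies of [f] being nonnegative, a block of this
    series is the pairing of [f] on a circle with a block of [sum_j sin(jt)/j].
    Such blocks are uniformly bounded, are small for [t] away from 0, and vanish
    at [t = 0]; so only mass of [|f(rho e^{it})|] sitting on a ring
    [eta <= |t| <= delta] can keep them from being small.  If this persisted for
    a fixed amount of mass as [delta] shrinks, infinitely many disjoint rings would
    each carry that amount for all [rho] close to 1, contradicting the bound on
    the means.  With smooth weights in place of rings this is the pigeonhole
    argument [exists_persistent_level].

    Analyticity is given by local power series, while the operator uses the
    expansion at 0.  The passage between the two is Cauchy's formula, obtained by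
    differentiating under the integral sign along the contraction of a circle to
    the point [z] ([cauchy_formula], [taylor]). *)

(** * Series of complex numbers *)

Notation is_Cseries := (is_series (K := C_AbsRing) (V := C_NormedModule)).

(** With [n] terms, so that the empty sum is available, whereas [sum_n c n] has
    [n + 1] terms. *)
Fixpoint csum (c : nat -> C) (n : nat) : C :=
  match n with O => RtoC 0 | S m => (csum c m + c m)%C end.

Fixpoint rsum (c : nat -> R) (n : nat) : R :=
  match n with O => 0 | S m => rsum c m + c m end.

Lemma sum_n_csum (c : nat -> C) n :
  sum_n (G := C_AbelianMonoid) c n = csum c (S n).
Proof.
  induction n as [|n IH].
  - rewrite sum_O. simpl. ring.
  - rewrite sum_Sn, IH. reflexivity.
Qed.

Lemma sum_n_rsum (c : nat -> R) n : sum_n c n = rsum c (S n).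
Proof.
  induction n as [|n IH].
  - rewrite sum_O. simpl. ring.
  - rewrite sum_Sn, IH. reflexivity.
Qed.

Lemma sum_n_m_csum (c : nat -> C) n l :
  sum_n_m (G := C_AbelianMonoid) c n (n + l) = csum (fun k => c (n + k)%nat) (S l).
Proof.
  induction l as [|l IH].
  - rewrite Nat.add_0_r, sum_n_n. simpl. rewrite Nat.add_0_r. ring.
  - rewrite Nat.add_succ_r, sum_n_Sm by lia. rewrite IH. simpl csum.
    rewrite !Nat.add_succ_r. reflexivity.
Qed.

Lemma is_Cseries_eps (c : nat -> C) (l : C) :
  is_Cseries c l <->
  forall eps, 0 < eps -> exists N, forall n, (N <= n)%nat ->
    Cmod (csum c n - l)%C < eps.
Proof.
  split.
  - intros H eps Heps.
    assert (Hl : locally (T := C_UniformSpace) l (fun y => Cmod (y - l)%C < eps)).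
    { assert (P := locally_ball_norm (V := C_NormedModule) l (mkposreal eps Heps)).
      revert P. apply filter_imp. intros y Hy. exact Hy. }
    destruct (H _ Hl) as [N HN].
    exists (S N). intros n Hn. destruct n as [|n]; [lia|].
    rewrite <- sum_n_csum. apply HN. lia.
  - intros H P HP.
    apply (locally_norm_le_locally (V := C_NormedModule) l P) in HP.
    destruct HP as [eps Heps].
    destruct (H eps (cond_pos eps)) as [N HN].
    exists N. intros n Hn. apply Heps.
    rewrite sum_n_csum. apply HN. lia.
Qed.

Lemma is_series_eps (c : nat -> R) (l : R) :
  is_series c l <->
  forall eps, 0 < eps -> exists N, forall n, (N <= n)%nat ->
    Rabs (rsum c n - l) < eps.
Proof.
  split.
  - intros H eps Heps.
    destruct (H _ (locally_ball l (mkposreal eps Heps))) as [N HN].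
    exists (S N). intros n Hn. destruct n as [|n]; [lia|].
    rewrite <- sum_n_rsum. apply HN. lia.
  - intros H P [eps Heps].
    destruct (H eps (cond_pos eps)) as [N HN].
    exists N. intros n Hn. apply Heps.
    rewrite sum_n_rsum. apply HN. lia.
Qed.

Lemma pow_n_Cpow (z : C) k : pow_n (K := C_Ring) z k = (z ^ k)%C.
Proof. induction k as [|k IH]; simpl; [reflexivity|]. rewrite IH. reflexivity. Qed.

Lemma is_pseries_Cseries (a : nat -> C) (z l : C) :
  is_pseries (K := C_AbsRing) (V := C_NormedModule) a z l <->
  is_Cseries (fun k => a k * z ^ k)%C l.
Proof.
  assert (E : forall k, scal (V := C_ModuleSpace) (pow_n (K := C_Ring) z k) (a k)
                        = (a k * z ^ k)%C).
  { intros k. rewrite pow_n_Cpow. apply Cmult_comm. }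
  split; apply (is_series_ext (K := C_AbsRing) (V := C_NormedModule)); intros n;
    [|symmetry]; apply E.
Qed.

Lemma csum_ext c d n : (forall k, (k < n)%nat -> c k = d k) -> csum c n = csum d n.
Proof.
  induction n as [|n IH]; intros H; simpl; auto.
  rewrite IH, H; auto.
Qed.

Lemma csum_scal (x : C) c n : csum (fun k => x * c k)%C n = (x * csum c n)%C.
Proof. induction n as [|n IH]; simpl; [ring|]. rewrite IH. ring. Qed.

Lemma csum_minus c d n : csum (fun k => c k - d k)%C n = (csum c n - csum d n)%C.
Proof. induction n as [|n IH]; simpl; [ring|]. rewrite IH. ring. Qed.

Lemma rsum_incr c m n : (forall k, 0 <= c k) -> (m <= n)%nat -> rsum c m <= rsum c n.
Proof.
  intros H Hmn. induction Hmn as [|n Hmn IH]; simpl; [lra|].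
  specialize (H n). lra.
Qed.

Lemma rsum_le_series c l n : (forall k, 0 <= c k) -> is_series c l -> rsum c n <= l.
Proof.
  intros H Hs.
  destruct (Rle_dec (rsum c n) l) as [|Hn]; auto.
  assert (Hp : 0 < rsum c n - l) by lra.
  destruct (proj1 (is_series_eps c l) Hs _ Hp) as [N HN].
  specialize (HN (max N n) (Nat.le_max_l _ _)).
  assert (Hi := rsum_incr c n (max N n) H (Nat.le_max_r _ _)).
  apply Rabs_def2 in HN. lra.
Qed.

Lemma csum_dist c (M : nat -> R) m n :
  (forall k, Cmod (c k) <= M k) -> (m <= n)%nat ->
  Cmod (csum c n - csum c m)%C <= rsum M n - rsum M m.
Proof.
  intros H Hmn. induction Hmn as [|n Hmn IH]; simpl.
  - replace (csum c m - csum c m)%C with (RtoC 0) by ring. rewrite Cmod_0. lra.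
  - replace (csum c n + c n - csum c m)%C with ((csum c n - csum c m) + c n)%C by ring.
    eapply Rle_trans; [apply Cmod_triangle|]. specialize (H n). lra.
Qed.

(** The tail of a dominated series is controlled by the tail of the dominating
    one; this is what makes termwise integration uniform on the circle. *)
Lemma csum_tail c M (l : C) S n :
  (forall k, Cmod (c k) <= M k) ->
  is_Cseries c l -> is_series M S ->
  Cmod (l - csum c n)%C <= S - rsum M n.
Proof.
  intros H Hc HM. apply le_epsilon. intros eps Heps.
  destruct (proj1 (is_Cseries_eps c l) Hc _ Heps) as [N HN].
  specialize (HN (max N n) (Nat.le_max_l _ _)).
  assert (Hd := csum_dist c M n (max N n) H (Nat.le_max_r _ _)).
  assert (HS : rsum M (max N n) <= S).
  { apply rsum_le_series; auto. intros k. eapply Rle_trans; [apply Cmod_ge_0|apply H]. }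
  replace (l - csum c n)%C with ((csum c (max N n) - csum c n) + - (csum c (max N n) - l))%C
    by ring.
  eapply Rle_trans; [apply Cmod_triangle|]. rewrite Cmod_opp. lra.
Qed.

Lemma csum_bound c M (l : C) S :
  (forall k, Cmod (c k) <= M k) ->
  is_Cseries c l -> is_series M S ->
  Cmod l <= S.
Proof.
  intros H Hc HM. assert (P := csum_tail c M l S 0 H Hc HM). simpl in P.
  replace (l - 0)%C with l in P by ring. lra.
Qed.

Lemma is_Cseries_unique (c : nat -> C) l l' :
  is_Cseries c l ->
  is_Cseries c l' -> l = l'.
Proof. apply (filterlim_locally_unique (K := C_AbsRing) (V := C_NormedModule)). Qed.

Lemma ex_Cseries_dominated (c : nat -> C) (M : nat -> R) :
  (forall k, Cmod (c k) <= M k) -> ex_series M ->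
  exists l, is_Cseries c l.
Proof.
  intros H HM.
  destruct (ex_series_le (K := R_AbsRing) (V := C_R_CompleteNormedModule) c M) as [l Hl]; auto.
  - intros n. specialize (H n). rewrite Cmod_norm in H. exact H.
  - exists l. exact Hl.
Qed.

Lemma is_Cseries_single (c : nat -> C) j :
  (forall k, k <> j -> c k = RtoC 0) ->
  is_Cseries c (c j).
Proof.
  intros H. apply is_Cseries_eps. intros eps Heps. exists (S j).
  assert (H0 : forall n, (n <= j)%nat -> csum c n = RtoC 0).
  { induction n as [|n IH]; intros Hn; simpl; auto.
    rewrite IH, H by lia. ring. }
  intros n Hn. assert (E : csum c n = c j).
  { induction Hn as [|n Hn IH]; simpl.
    - rewrite H0 by lia. ring.
    - rewrite IH, (H n) by lia. ring. }
  rewrite E. replace (c j - c j)%C with (RtoC 0) by ring. now rewrite Cmod_0.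
Qed.

Lemma is_Cseries_scal (x : C) (c : nat -> C) l :
  is_Cseries c l ->
  is_Cseries (fun k => x * c k)%C (x * l)%C.
Proof. intros H. exact (is_series_scal (K := C_AbsRing) (V := C_NormedModule) x c l H). Qed.

Lemma is_Cseries_minus (c d : nat -> C) l l' :
  is_Cseries c l ->
  is_Cseries d l' ->
  is_Cseries (fun k => c k - d k)%C (l - l')%C.
Proof.
  intros H H'. exact (is_series_minus (K := C_AbsRing) (V := C_NormedModule) c d l l' H H').
  
Qed.

Lemma is_Cseries_terms_bounded (c : nat -> C) l :
  is_Cseries c l ->
  exists B, forall k, Cmod (c k) <= B.
Proof.
  intros H. destruct (proj1 (is_Cseries_eps c l) H 1 Rlt_0_1) as [N HN].
  assert (F : forall n, exists B, forall k, (k < n)%nat -> Cmod (c k) <= B).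
  { induction n as [|n [B HB]]; [exists 0; lia|].
    exists (Rmax B (Cmod (c n))). intros k Hk.
    destruct (Nat.eq_dec k n) as [->|]; [apply Rmax_r|].
    eapply Rle_trans; [apply HB; lia|apply Rmax_l]. }
  destruct (F N) as [B HB]. exists (Rmax B 2). intros k.
  destruct (Nat.lt_ge_cases k N) as [Hk|Hk].
  - eapply Rle_trans; [now apply HB|apply Rmax_l].
  - eapply Rle_trans; [|apply Rmax_r].
    assert (H1 := HN k Hk). assert (H2 := HN (S k) (Nat.le_trans _ _ _ Hk (Nat.le_succ_diag_r _))).
    simpl in H2. replace (c k) with ((csum c k + c k - l) + - (csum c k - l))%C by ring.
    eapply Rle_trans; [apply Cmod_triangle|]. rewrite Cmod_opp. lra.
Qed.

Lemma is_Cseries_ext (c d : nat -> C) l : (forall k, c k = d k) ->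
  is_Cseries c l ->
  is_Cseries d l.
Proof. apply is_series_ext. Qed.

Lemma is_series_ext_real (c d : nat -> R) (l : R) : (forall k, c k = d k) ->
  is_series c l -> is_series d l.
Proof. apply is_series_ext. Qed.

(** A total sum operator, through real and imaginary parts, which lets sums
    be used as functions of a parameter without a choice principle. *)
Definition CSeries (c : nat -> C) : C :=
  (Series (fun k => Re (c k)), Series (fun k => Im (c k))).

Lemma csum_ReIm c n : csum c n = (rsum (fun k => Re (c k)) n, rsum (fun k => Im (c k)) n).
Proof.
  induction n as [|n IH]; simpl; [reflexivity|]. rewrite IH. reflexivity.
Qed.

Lemma Cmod_fst_le (z : C) : Rabs (fst z) <= Cmod z.
Proof. eapply Rle_trans; [apply Rmax_l|apply Rmax_Cmod]. Qed.

Lemma Cmod_snd_le (z : C) : Rabs (snd z) <= Cmod z.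
Proof. eapply Rle_trans; [apply Rmax_r|apply Rmax_Cmod]. Qed.

Lemma is_Cseries_ReIm (c : nat -> C) l :
  is_Cseries c l ->
  is_series (fun k => Re (c k)) (Re l) /\ is_series (fun k => Im (c k)) (Im l).
Proof.
  intros H. split; apply is_series_eps; intros eps Heps;
  destruct (proj1 (is_Cseries_eps c l) H eps Heps) as [N HN];
  exists N; intros n Hn; specialize (HN n Hn); rewrite csum_ReIm in HN;
  eapply Rle_lt_trans; try exact HN.
  - apply (Cmod_fst_le (_, _)).
  - apply (Cmod_snd_le (_, _)).
Qed.

Lemma CSeries_unique (c : nat -> C) l :
  is_Cseries c l -> CSeries c = l.
Proof.
  intros H. destruct (is_Cseries_ReIm c l H) as [H1 H2].
  unfold CSeries. rewrite (is_series_unique _ _ H1), (is_series_unique _ _ H2).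
  now destruct l.
Qed.

Lemma is_Cseries_shift (d : nat -> C) l : d O = RtoC 0 ->
  is_Cseries (fun k => d (S k)) l ->
  is_Cseries d l.
Proof.
  intros H0 H. apply is_Cseries_eps. intros eps Heps.
  destruct (proj1 (is_Cseries_eps _ l) H eps Heps) as [N HN].
  exists (S N). intros [|n] Hn; [lia|].
  assert (E : csum d (S n) = csum (fun k => d (S k)) n).
  { clear -H0. induction n as [|n IH]; simpl.
    - rewrite H0. ring.
    - simpl in IH. rewrite IH. reflexivity. }
  rewrite E. apply HN. lia.
Qed.

Lemma is_series_shift (d : nat -> R) l : d O = 0 ->
  is_series (fun k => d (S k)) l -> is_series d l.
Proof.
  intros H0 H. apply is_series_decr_1. rewrite H0.
  change (is_series (fun k => d (S k)) (l + - 0)). now rewrite Ropp_0, Rplus_0_r.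

Qed.

(** * Differentiating complex power series *)

(** Complex differentiability in the first-order form with a non-strict bound,
    which can be used at [h = 0] too and composes without dividing. *)
Definition cderiv (f : C -> C) (z l : C) : Prop :=
  forall eps, 0 < eps -> exists delta, 0 < delta /\ forall h : C, Cmod h < delta ->
    Cmod (f (z + h) - f z - l * h)%C <= eps * Cmod h.

(** Expanding the left side by the binomial theorem leaves only nonnegative
    coefficients, so its modulus is at most its value at [|z|], [|h|].  This reduces
    the differentiation of a complex power series to that of a real one. *)
Lemma Cpow_remainder (z h : C) k :
  Cmod ((z + h) ^ k - z ^ k - INR k * h * z ^ pred k)%C
  <= (Cmod z + Cmod h) ^ k - Cmod z ^ k - INR k * Cmod h * Cmod z ^ pred k.
Proof.
  induction k as [|k IH].
  - simpl. replace (1 - 1 - 0 * h * 1)%C with (RtoC 0) by ring. rewrite Cmod_0. lra.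
  - set (x := Cmod z) in *. set (y := Cmod h) in *.
    replace ((x + y) ^ S k - x ^ S k - INR (S k) * y * x ^ pred (S k))
    with ((x + y) * ((x + y) ^ k - x ^ k - INR k * y * x ^ pred k)
          + INR k * (y * y) * x ^ pred k).
    2:{ rewrite S_INR. destruct k as [|k]; simpl pred; [simpl; ring|]. simpl pow. ring. }
    replace ((z + h) ^ S k - z ^ S k - INR (S k) * h * z ^ pred (S k))%C
    with ((z + h) * ((z + h) ^ k - z ^ k - INR k * h * z ^ pred k)
          + INR k * (h * h) * z ^ pred k)%C.
    2:{ rewrite S_INR, RtoC_plus. destruct k as [|k]; simpl pred; [simpl; ring|]. simpl Cpow.
        ring. }
    eapply Rle_trans; [apply Cmod_triangle|]. apply Rplus_le_compat.
    + rewrite Cmod_mult. apply Rmult_le_compat; try apply Cmod_ge_0; auto.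
      apply Cmod_triangle.
    + rewrite !Cmod_mult, Cmod_pow, Cmod_R, Rabs_pos_eq by apply pos_INR.
      apply Rle_refl.
Qed.

(** Convergence at a point slightly beyond [x] bounds the terms there. *)
Lemma CV_radius_abs (a : nat -> C) (g : C -> C) R x :
  (forall z, Cmod z < R -> is_Cseries
     (fun k => a k * z ^ k)%C (g z)) ->
  0 <= x < R -> Rbar_lt x (CV_radius (fun k => Cmod (a k))).
Proof.
  intros H Hx. set (y := (x + R) / 2).
  apply Rbar_lt_le_trans with y; [simpl; unfold y; lra|].
  apply (CV_radius_bounded (fun k => Cmod (a k))).
  assert (Hy : Cmod (RtoC y) < R).
  { rewrite Cmod_R, Rabs_pos_eq; unfold y; lra. }
  destruct (is_Cseries_terms_bounded _ _ (H _ Hy)) as [B HB].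
  exists B. intros n. specialize (HB n).
  rewrite Cmod_mult, Cmod_pow, Cmod_R in HB.
  rewrite Rabs_mult, <- RPow_abs, (Rabs_pos_eq (Cmod _)); [exact HB|apply Cmod_ge_0].
Qed.

Lemma pseries_abs_conv (a : nat -> C) (g : C -> C) R x :
  (forall z, Cmod z < R -> is_Cseries
     (fun k => a k * z ^ k)%C (g z)) ->
  0 <= x < R -> ex_series (fun k => Cmod (a k) * x ^ k).
Proof.
  intros H Hx. assert (P := CV_radius_abs a g R x H Hx).
  apply ex_pseries_R. apply CV_radius_inside. rewrite Rabs_pos_eq by lra. exact P.
Qed.

(** The first-order remainder of [f] at [z] is dominated, via [Cpow_remainder], by
    that of the real series [sum |a_k| x^k] at [|z|], whose differentiability is
    known. *)
Lemma pseries_cderiv (a : nat -> C) (f : C -> C) R :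
  (forall z, Cmod z < R -> is_Cseries
     (fun k => a k * z ^ k)%C (f z)) ->
  exists f' : C -> C, forall z, Cmod z < R ->
    is_Cseries
      (fun k => INR (S k) * a (S k) * z ^ k)%C (f' z) /\ cderiv f z (f' z).
Proof.
  intros H.
  set (A := fun k => Cmod (a k)).
  exists (fun z => CSeries (fun k => INR (S k) * a (S k) * z ^ k)%C).
  intros z Hz. set (x := Cmod z) in *.
  assert (Hx0 : 0 <= x) by apply Cmod_ge_0.
  assert (Hx : Rbar_lt (Rabs x) (CV_radius A)).
  { rewrite Rabs_pos_eq by lra. apply (CV_radius_abs a f R); auto; lra. }
  assert (Hd : is_series (fun k => INR (S k) * Cmod (a (S k)) * x ^ k) (PSeries (PS_derive A) x)).
  { apply Series_correct. apply (ex_pseries_R (PS_derive A) x). now apply ex_pseries_derive. }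
  assert (Hs : is_Cseries
      (fun k => INR (S k) * a (S k) * z ^ k)%C (CSeries (fun k => INR (S k) * a (S k) * z ^ k)%C)).
  { destruct (ex_Cseries_dominated (fun k => INR (S k) * a (S k) * z ^ k)%C
      (fun k => INR (S k) * Cmod (a (S k)) * x ^ k)) as [l Hl].
    - intros k. rewrite !Cmod_mult, Cmod_pow, Cmod_R, Rabs_pos_eq by apply pos_INR. apply Rle_refl.
    - eexists; exact Hd.
    - rewrite (CSeries_unique _ _ Hl). exact Hl. }
  split; [exact Hs|].
  set (l := CSeries _) in *. clearbody l.
  assert (HdA := is_derive_PSeries A x Hx).
  intros eps Heps.
  destruct HdA as [_ HdA].
  specialize (HdA x (fun P HP => HP) (mkposreal eps Heps)).
  destruct HdA as [d Hdd]. simpl in Hdd.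
  exists (Rmin d (R - x)). split.
  { apply Rmin_pos; [apply cond_pos|lra]. }
  intros h Hh. set (y := Cmod h) in *.
  assert (Hy0 : 0 <= y) by apply Cmod_ge_0.
  assert (Hyd : y < d) by (eapply Rlt_le_trans; [exact Hh|apply Rmin_l]).
  assert (HyR : y < R - x) by (eapply Rlt_le_trans; [exact Hh|apply Rmin_r]).
  assert (Hzh : Cmod (z + h)%C < R).
  { eapply Rle_lt_trans; [apply Cmod_triangle|]. fold x y. lra. }
  assert (Hser : is_Cseries
    (fun k => a k * ((z + h) ^ k - z ^ k - INR k * h * z ^ pred k))%C
    (f (z + h) - f z - l * h)%C).
  { assert (E1 := is_Cseries_minus _ _ _ _ (H _ Hzh) (H _ Hz)).
    assert (E2 : is_Cseries
       (fun k => h * (INR k * a k * z ^ pred k))%C (h * l)%C).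
    { apply is_Cseries_scal. apply is_Cseries_shift; [simpl; ring|exact Hs]. }
    assert (E3 := is_Cseries_minus _ _ _ _ E1 E2).
    replace (f (z + h) - f z - l * h)%C with (f (z + h)%C - f z - h * l)%C by ring.
    revert E3. apply is_Cseries_ext. intros k. ring. }
  assert (Hreal : is_series
    (fun k => A k * ((x + y) ^ k - x ^ k - INR k * y * x ^ pred k))
    (PSeries A (x + y) - PSeries A x - y * PSeries (PS_derive A) x)).
  { assert (C1 : forall t, 0 <= t < R -> is_series (fun k => A k * t ^ k) (PSeries A t)).
    { intros t Ht. apply Series_correct. apply ex_pseries_R. apply CV_radius_inside.
      rewrite Rabs_pos_eq by lra. now apply (CV_radius_abs a f R). }
    assert (E1 : is_series (fun k => A k * (x + y) ^ k - A k * x ^ k) (PSeries A (x + y) - PSeries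
      A x)).
    { apply (is_series_minus (V := R_NormedModule) (fun k => A k * (x + y) ^ k) (fun k =>
        A k * x ^ k));
      apply C1; lra. }
    assert (E2 : is_series (fun k => y * (INR k * A k * x ^ pred k)) (y * PSeries (PS_derive A) x)).
    { apply (is_series_scal (V := R_NormedModule) y (fun k => INR k * A k * x ^ pred k)).
      apply is_series_shift; [simpl; ring|]. exact Hd. }
    assert (E3 := is_series_minus (V := R_NormedModule) _ _ _ _ E1 E2).
    revert E3. apply is_series_ext_real. intros k. unfold plus, opp, minus; simpl. ring. }
  eapply Rle_trans.
  { eapply csum_bound; [|exact Hser|exact Hreal]. intros k. simpl.
    rewrite Cmod_mult. apply Rmult_le_compat_l; [apply Cmod_ge_0|apply Cpow_remainder]. }
  assert (Hb : ball x d (x + y)).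
  { unfold ball; simpl. unfold AbsRing_ball, abs, minus, plus, opp; simpl.
    replace (x + y + - x) with y by ring. rewrite Rabs_pos_eq; lra. }
  specialize (Hdd _ Hb). unfold norm, minus, plus, opp, scal in Hdd; simpl in Hdd.
  unfold abs, mult in Hdd; simpl in Hdd.
  replace (x + y + - x) with y in Hdd by ring. rewrite (Rabs_pos_eq y) in Hdd by lra.
  eapply Rle_trans; [|exact Hdd]. eapply Rle_trans; [|apply Rle_abs]. lra.
Qed.

(** * Continuity of real and complex functions *)

Section RealContinuity.
Context {U : UniformSpace}.
Implicit Types F G : U -> R.

Lemma continuous_Rmult F G x : continuous F x -> continuous G x -> continuous (fun u =>
  F u * G u) x.
Proof. apply (continuous_mult (K := R_AbsRing)). Qed.

Lemma continuous_Rplus F G x : continuous F x -> continuous G x -> continuous (fun u =>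
  F u + G u) x.
Proof. apply (continuous_plus (V := R_NormedModule)). Qed.

Lemma continuous_Rminus F G x : continuous F x -> continuous G x -> continuous (fun u =>
  F u - G u) x.
Proof. apply (continuous_minus (V := R_NormedModule)). Qed.

Lemma continuous_Rinv F x : continuous F x -> F x <> 0 -> continuous (fun u => / F u) x.
Proof.
  intros HF H0. apply (continuous_comp F Rinv); [exact HF|].
  apply continuity_pt_filterlim, continuity_pt_inv; [apply continuity_pt_id|exact H0].
Qed.
End RealContinuity.

Lemma continuous_fst_R2 (p : R * R) : continuous (fun p : R * R => fst p) p.
Proof. apply (continuous_fst (U := R_UniformSpace) (V := R_UniformSpace)). Qed.

Lemma continuous_snd_R2 (p : R * R) : continuous (fun p : R * R => snd p) p.
Proof. apply (continuous_snd (U := R_UniformSpace) (V := R_UniformSpace)). Qed.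

Lemma continuous_cos_R2 (p : R * R) : continuous (fun p : R * R => cos (snd p)) p.
Proof.
  apply (continuous_comp (fun p : R * R => snd p) cos);
  [apply continuous_snd_R2|apply continuous_cos].
Qed.

Section Continuity.
Context {U : UniformSpace}.
Implicit Types F G : U -> C.

Lemma continuous_C_intro F x :
  continuous (fun u => fst (F u)) x -> continuous (fun u => snd (F u)) x -> continuous F x.
Proof.
  intros H1 H2.
  apply (continuous_ext (fun u => (fst (F u), snd (F u)))).
  { intros u. now destruct (F u). }
  unfold continuous. simpl.
  intros P [eps HP].
  assert (Q1 := H1 _ (locally_ball (fst (F x)) eps)).
  assert (Q2 := H2 _ (locally_ball (snd (F x)) eps)).
  unfold filtermap in *.
  generalize (filter_and _ _ Q1 Q2). apply filter_imp. intros u [h1 h2].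
  apply HP. split; assumption.
Qed.

Lemma continuous_C_fst F x : continuous F x -> continuous (fun u => fst (F u)) x.
Proof.
  intros H. apply (continuous_comp F fst); [exact H|].
  apply (continuous_fst (U := R_UniformSpace) (V := R_UniformSpace)).
Qed.

Lemma continuous_C_snd F x : continuous F x -> continuous (fun u => snd (F u)) x.
Proof.
  intros H. apply (continuous_comp F snd); [exact H|].
  apply (continuous_snd (U := R_UniformSpace) (V := R_UniformSpace)).
Qed.

Lemma continuous_Cplus F G x : continuous F x -> continuous G x ->
  continuous (fun u => F u + G u)%C x.
Proof.
  intros HF HG. apply continuous_C_intro; simpl.
  - apply continuous_Rplus; now apply continuous_C_fst.
  - apply continuous_Rplus; now apply continuous_C_snd.
Qed.

Lemma continuous_Cmult F G x : continuous F x -> continuous G x ->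
  continuous (fun u => F u * G u)%C x.
Proof.
  intros HF HG.
  assert (HF1 := continuous_C_fst _ _ HF). assert (HF2 := continuous_C_snd _ _ HF).
  assert (HG1 := continuous_C_fst _ _ HG). assert (HG2 := continuous_C_snd _ _ HG).
  apply continuous_C_intro; simpl.
  - now apply continuous_Rminus; apply continuous_Rmult.
  - now apply continuous_Rplus; apply continuous_Rmult.
Qed.

Lemma continuous_Copp F x : continuous F x -> continuous (fun u => - F u)%C x.
Proof.
  intros HF. apply continuous_C_intro; simpl.
  - apply (continuous_opp (V := R_NormedModule)). now apply continuous_C_fst.
  - apply (continuous_opp (V := R_NormedModule)). now apply continuous_C_snd.
Qed.

Lemma continuous_Cminus F G x : continuous F x -> continuous G x ->
  continuous (fun u => F u - G u)%C x.
Proof. intros HF HG. apply continuous_Cplus; [exact HF|now apply continuous_Copp]. Qed.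

Lemma continuous_RtoC (r : U -> R) x : continuous r x -> continuous (fun u => RtoC (r u)) x.
Proof. intros H. apply continuous_C_intro; simpl; [exact H|apply continuous_const]. Qed.

Lemma continuous_Cmod F x : continuous F x -> continuous (fun u => Cmod (F u)) x.
Proof.
  intros H. apply (continuous_comp F Cmod); [exact H|].
  apply (filterlim_norm (K := C_AbsRing) (V := C_NormedModule)).
Qed.

Lemma continuous_Cinv F x : continuous F x -> F x <> RtoC 0 ->
  continuous (fun u => / F u)%C x.
Proof.
  intros HF H0.
  assert (HF1 := continuous_C_fst _ _ HF). assert (HF2 := continuous_C_snd _ _ HF).
  assert (D : continuous (fun u => / (fst (F u) ^ 2 + snd (F u) ^ 2)) x).
  { apply continuous_Rinv.
    - apply continuous_Rplus; apply continuous_Rmult; auto;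
        apply continuous_Rmult; auto; apply continuous_const.
    - intros E. apply H0. destruct (F x) as [p q]; simpl in E.
      assert (p = 0) by nra. assert (q = 0) by nra. subst. reflexivity. }
  apply continuous_C_intro; simpl.
  - now apply continuous_Rmult.
  - apply continuous_Rmult; auto. now apply (continuous_opp (V := R_NormedModule)).
Qed.

Lemma continuous_Cconst (c : C) x : continuous (fun _ : U => c) x.
Proof. apply continuous_const. Qed.

Lemma continuous_Cpow F k x : continuous F x -> continuous (fun u => F u ^ k)%C x.
Proof.
  intros H. induction k as [|k IH]; simpl.
  - apply continuous_Cconst.
  - now apply continuous_Cmult.
Qed.

Lemma continuous_csum (F : nat -> U -> C) n x : (forall k, continuous (F k) x) ->
  continuous (fun u => csum (fun k => F k u) n) x.
Proof.
  intros H. induction n as [|n IH]; simpl.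
  - apply continuous_Cconst.
  - now apply continuous_Cplus.
Qed.
End Continuity.

(** * Integrals over the circle *)

Definition cis (x : R) : C := (cos x, sin x).

Lemma cis_plus x y : cis (x + y) = (cis x * cis y)%C.
Proof.
  unfold cis, Cmult; simpl. rewrite cos_plus, sin_plus. apply injective_projections; simpl; ring.
Qed.

Lemma cis_0 : cis 0 = RtoC 1.
Proof. unfold cis. now rewrite cos_0, sin_0. Qed.

Lemma cis_pow x k : (cis x ^ k)%C = cis (INR k * x).
Proof.
  induction k as [|k IH].
  - simpl. now rewrite Rmult_0_l, cis_0.
  - rewrite S_INR. simpl Cpow. rewrite IH.
    replace ((INR k + 1) * x) with (x + INR k * x) by ring. now rewrite cis_plus.
Qed.

Lemma Cmod_cis x : Cmod (cis x) = 1.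
Proof.
  unfold Cmod, cis; simpl.
  replace (cos x * (cos x * 1) + sin x * (sin x * 1)) with 1; [apply sqrt_1|].
  assert (P := sin2_cos2 x). unfold Rsqr in P. lra.
Qed.

Lemma cis_nz x : cis x <> RtoC 0.
Proof. intros E. assert (P := Cmod_cis x). rewrite E, Cmod_0 in P. lra. Qed.

Lemma cis_opp x : cis (- x) = (/ cis x)%C.
Proof.
  assert (E : (cis (- x) * cis x = 1)%C).
  { rewrite <- cis_plus. replace (- x + x) with 0 by ring. apply cis_0. }
  replace (cis (- x)) with (cis (- x) * cis x * / cis x)%C by (field; apply cis_nz).
  rewrite E. ring.
Qed.

Lemma cis_2kPI k : cis (INR k * (2 * PI)) = RtoC 1.
Proof.
  unfold cis. replace (INR k * (2 * PI)) with (0 + 2 * INR k * PI) by ring.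
  now rewrite cos_period, sin_period, cos_0, sin_0.
Qed.

Lemma continuous_cis {U : UniformSpace} (r : U -> R) x :
  continuous r x -> continuous (fun u => cis (r u)) x.
Proof.
  intros H. apply continuous_C_intro; simpl.
  - apply (continuous_comp r cos); [exact H|apply continuous_cos].
  - apply (continuous_comp r sin); [exact H|apply continuous_sin].
Qed.

Lemma ex_RInt_cont (f : R -> R) a b : (forall t, continuous f t) -> ex_RInt f a b.
Proof. intros H. apply (ex_RInt_continuous (V := R_CompleteNormedModule)). intros; apply H. Qed.

(** Differentiation under the integral sign, with the partial derivative given
    explicitly so that no call to [Derive] has to be rewritten under the integral. *)
Lemma is_derive_RInt_periodic (F dF : R -> R -> R) x eta : 0 < eta ->
  (forall u t, Rabs (u - x) < eta -> is_derive (fun u => F u t) u (dF u t)) ->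
  (forall u t, Rabs (u - x) < eta -> continuous (F u) t) ->
  (forall t, continuous (fun p : R * R => dF (fst p) (snd p)) (x, t)) ->
  is_derive (fun u => RInt (F u) 0 (2 * PI)) x (RInt (dF x) 0 (2 * PI)).
Proof.
  intros He HD HF Hd.
  assert (Hloc : locally x (fun u => Rabs (u - x) < eta)).
  { exists (mkposreal eta He). intros y Hy. exact Hy. }
  assert (E0 : RInt (fun t => Derive (fun u => F u t) x) 0 (2 * PI) = RInt (dF x) 0 (2 * PI)).
  { apply RInt_ext. intros t _. apply is_derive_unique, HD. now rewrite Rminus_diag, Rabs_R0. }
  assert (D := is_derive_RInt_param F 0 (2 * PI) x).
  cbv beta in D. rewrite E0 in D. apply D; clear D.
  - revert Hloc. apply filter_imp. intros u Hu t _. eexists. now apply HD.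
  - intros t _. apply (continuity_2d_pt_ext_loc dF).
    + exists (mkposreal eta He). intros u v Hu _. symmetry. now apply is_derive_unique, HD.
    + apply continuity_2d_pt_filterlim. apply Hd.
  - revert Hloc. apply filter_imp. intros u Hu. apply ex_RInt_cont. intros t. now apply HF.
Qed.

(** Componentwise, so that the theory of real integrals applies directly. *)
Definition CI (F : R -> C) : C :=
  (RInt (fun t => fst (F t)) 0 (2 * PI), RInt (fun t => snd (F t)) 0 (2 * PI)).

Lemma CI_ext F G : (forall t, F t = G t) -> CI F = CI G.
Proof.
  intros H. unfold CI. f_equal; apply RInt_ext; intros t _; now rewrite H.
Qed.

Lemma CI_plus F G : (forall t, continuous F t) -> (forall t, continuous G t) ->
  CI (fun t => F t + G t)%C = (CI F + CI G)%C.
Proof.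
  intros HF HG. unfold CI, Cplus; simpl. f_equal.
  - apply (RInt_plus (V := R_CompleteNormedModule) (fun t => fst (F t)) (fun t => fst (G t)));
    apply ex_RInt_cont; intros t; now apply continuous_C_fst.
  - apply (RInt_plus (V := R_CompleteNormedModule) (fun t => snd (F t)) (fun t => snd (G t)));
    apply ex_RInt_cont; intros t; now apply continuous_C_snd.
Qed.

Lemma RInt_lin (f g : R -> R) a b p q : (forall t, continuous f t) -> (forall t, continuous g t) ->
  RInt (fun t => p * f t + q * g t) a b = p * RInt f a b + q * RInt g a b.
Proof.
  intros Hf Hg.
  assert (Ef := ex_RInt_cont f a b Hf). assert (Eg := ex_RInt_cont g a b Hg).
  rewrite (RInt_plus (V := R_CompleteNormedModule) (fun t => p * f t) (fun t => q * g t)).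
  - rewrite (RInt_scal (V := R_CompleteNormedModule) f),
      (RInt_scal (V := R_CompleteNormedModule) g); auto.
  - now apply (ex_RInt_scal (V := R_NormedModule) f).
  - now apply (ex_RInt_scal (V := R_NormedModule) g).
Qed.

Lemma CI_scal c F : (forall t, continuous F t) -> CI (fun t => c * F t)%C = (c * CI F)%C.
Proof.
  intros HF. unfold CI, Cmult; simpl.
  assert (H1 : forall t, continuous (fun t => fst (F t)) t) by (intros; now apply continuous_C_fst).
  assert (H2 : forall t, continuous (fun t => snd (F t)) t) by (intros; now apply continuous_C_snd).
  f_equal.
  -
    replace (fst c * RInt (fun t => fst (F t)) 0 (2 * PI) - snd c * RInt (fun t =>
      snd (F t)) 0 (2 * PI))
    with (fst c * RInt (fun t => fst (F t)) 0 (2 * PI) + (- snd c) * RInt (fun t =>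
      snd (F t)) 0 (2 * PI)) by ring.
    rewrite <- RInt_lin by assumption. apply (RInt_ext (V := R_CompleteNormedModule)); intros t _;
      simpl; unfold Rminus; apply (f_equal2 Rplus); ring.
  - rewrite <- RInt_lin by assumption. apply (RInt_ext (V := R_CompleteNormedModule)); intros t _;
      simpl; unfold Rminus; apply (f_equal2 Rplus); ring.
Qed.

Lemma CI_minus F G : (forall t, continuous F t) -> (forall t, continuous G t) ->
  CI (fun t => F t - G t)%C = (CI F - CI G)%C.
Proof.
  intros HF HG.
  transitivity (CI (fun t => F t + (-(1)) * G t))%C.
  { apply CI_ext; intros; ring. }
  rewrite CI_plus; auto.
  - rewrite CI_scal by auto. ring.
  - intros t. apply continuous_Cmult; auto. apply continuous_Cconst.
Qed.

Lemma CI_const c : CI (fun _ => c) = (2 * PI * c)%C.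
Proof.
  unfold CI. rewrite !RInt_const. unfold scal; simpl; unfold mult; simpl.
  unfold Cmult; simpl. apply injective_projections; simpl; ring.
Qed.

Lemma RInt_cont_le (f g : R -> R) : (forall t, continuous f t) -> (forall t, continuous g t) ->
  (forall t, 0 <= t <= 2 * PI -> f t <= g t) ->
  RInt f 0 (2 * PI) <= RInt g 0 (2 * PI).
Proof.
  intros Hf Hg H. assert (P := PI_RGT_0). apply RInt_le; try (apply ex_RInt_cont; assumption).
  - lra.
  - intros t Ht. apply H. lra.
Qed.

Lemma CI_norm F (g : R -> R) : (forall t, continuous F t) -> (forall t, continuous g t) ->
  (forall t, 0 <= t <= 2 * PI -> Cmod (F t) <= g t) ->
  Cmod (CI F) <= RInt g 0 (2 * PI).
Proof.
  intros HF Hg H. assert (P := PI_RGT_0). rewrite Cmod_norm.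
  apply (norm_RInt_le (V := C_R_NormedModule) F g 0 (2 * PI)).
  - lra.
  - intros t Ht. rewrite <- Cmod_norm. now apply H.
  - apply (is_RInt_fct_extend_pair (U := R_NormedModule) (V := R_NormedModule)).
    + apply (RInt_correct (V := R_CompleteNormedModule)), ex_RInt_cont. intros;
        now apply continuous_C_fst.
    + apply (RInt_correct (V := R_CompleteNormedModule)), ex_RInt_cont. intros;
        now apply continuous_C_snd.
  - apply (RInt_correct (V := R_CompleteNormedModule)), ex_RInt_cont, Hg.
Qed.

Lemma CI_bound F B : (forall t, continuous F t) ->
  (forall t, 0 <= t <= 2 * PI -> Cmod (F t) <= B) -> Cmod (CI F) <= 2 * PI * B.
Proof.
  intros HF H. eapply Rle_trans.
  - apply (CI_norm F (fun _ => B)); auto. intros; apply continuous_const.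
  - rewrite RInt_const. unfold scal; simpl; unfold mult; simpl. lra.
Qed.

Lemma CI_csum (F : nat -> R -> C) n : (forall k t, continuous (F k) t) ->
  CI (fun t => csum (fun k => F k t) n) = csum (fun k => CI (F k)) n.
Proof.
  intros H. induction n as [|n IH]; simpl.
  - rewrite CI_const. ring.
  - rewrite CI_plus, IH; auto. intros t. now apply continuous_csum.
Qed.

(** Since [|u| <= 1], the tails of [sum c_k u^k] are small uniformly in [t], and
    [K] is bounded on the period. *)
Lemma CI_series (c : nat -> C) (u F K : R -> C) :
  ex_series (fun k => Cmod (c k)) ->
  (forall t, continuous u t) -> (forall t, Cmod (u t) <= 1) ->
  (forall t, continuous F t) -> (forall t, continuous K t) ->
  (forall t, is_Cseries (fun k => c k * u t ^ k)%C (F t)) ->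
  is_Cseries
    (fun k => c k * CI (fun t => u t ^ k * K t))%C (CI (fun t => F t * K t)%C).
Proof.
  intros [S HS] Hu Hu1 HF HK H. apply is_Cseries_eps. intros eps Heps.
  assert (HB : exists B, 0 < B /\ forall t, 0 <= t <= 2 * PI -> Cmod (K t) <= B).
  { assert (P := PI_RGT_0).
    destruct (continuity_ab_maj (fun t => Cmod (K t)) 0 (2 * PI)) as [m [Hm _]]; [lra| |].
    - intros t _. apply continuity_pt_filterlim. apply (continuous_Cmod K t (HK t)).
    - exists (Cmod (K m) + 1). split; [assert (Q := Cmod_ge_0 (K m)); lra|].
      intros t Ht. specialize (Hm t Ht). simpl in Hm. lra. }
  destruct HB as [B [HB0 HB]].
  assert (P := PI_RGT_0).
  assert (Hk : forall k t, continuous (fun t => c k * (u t ^ k * K t))%C t).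
  { intros. apply continuous_Cmult; [apply continuous_Cconst|].
    apply continuous_Cmult; auto. now apply continuous_Cpow. }
  assert (He : 0 < eps / (2 * PI * B) / 2).
  { apply Rdiv_lt_0_compat; [apply Rdiv_lt_0_compat|]; try lra. apply Rmult_lt_0_compat; lra. }
  destruct (proj1 (is_series_eps _ S) HS _ He) as [N HN].
  exists N. intros n Hn.
  specialize (HN n Hn).
  assert (E : csum (fun k => c k * CI (fun t => u t ^ k * K t))%C n
             = CI (fun t => csum (fun k => c k * (u t ^ k * K t))%C n)).
  { rewrite CI_csum by auto. apply csum_ext. intros k _. symmetry. apply CI_scal.
    intros t. apply continuous_Cmult; auto. now apply continuous_Cpow. }
  rewrite E, <- CI_minus.
  - assert (Hb : forall t, 0 <= t <= 2 * PI ->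
      Cmod (csum (fun k => c k * (u t ^ k * K t)) n - F t * K t)%C
      <= (eps / (2 * PI * B) / 2) * B).
    { intros t Ht.
      replace (csum (fun k => c k * (u t ^ k * K t)) n - F t * K t)%C
      with (- (F t - csum (fun k => c k * u t ^ k) n) * K t)%C.
      2:{ rewrite (csum_ext (fun k => c k * (u t ^ k * K t))%C (fun k => K t * (c k * u t ^ k))%C)
            by (intros; ring).
          rewrite csum_scal. ring. }
      rewrite Cmod_mult, Cmod_opp. apply Rmult_le_compat; try apply Cmod_ge_0; auto.
      eapply Rle_trans; [apply (csum_tail _ (fun k => Cmod (c k)) _ S)|].
      - intros k. rewrite Cmod_mult, Cmod_pow. rewrite <- (Rmult_1_r (Cmod (c k))) at 2.
        apply Rmult_le_compat_l; [apply Cmod_ge_0|].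
        rewrite <- (pow1 k). apply pow_incr. split; [apply Cmod_ge_0|apply Hu1].
      - apply H.
      - exact HS.
      - apply Rabs_def2 in HN. lra. }
    eapply Rle_lt_trans; [apply CI_bound; [|exact Hb]|].
    + intros t. apply continuous_Cminus; [now apply continuous_csum|].
      apply continuous_Cmult; auto.
    + replace (2 * PI * (eps / (2 * PI * B) / 2 * B)) with (eps / 2) by (field; lra). lra.
  - intros t. now apply continuous_csum.
  - intros t. apply continuous_Cmult; auto.
Qed.

Lemma CI_cis_0 a : a <> 0 -> cis (a * (2 * PI)) = RtoC 1 -> CI (fun t => cis (a * t)) = RtoC 0.
Proof.
  intros Ha H. injection H as Hc Hs. unfold CI, cis; simpl. apply injective_projections; simpl.
  - rewrite (is_RInt_unique _ _ _ (sin (a * (2 * PI)) / a - sin (a * 0) / a)).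
    + rewrite Hs, Rmult_0_r, sin_0. field; auto.
    + apply (is_RInt_derive (V := R_CompleteNormedModule) (fun t => sin (a * t) / a)).
      * intros t _. auto_derive; [auto|field; auto].
      * intros t _. apply (continuous_comp (fun t => a * t) cos); [|apply continuous_cos].
        apply (continuous_scal_r (V := R_NormedModule) a (fun t => t)). apply continuous_id.
  - rewrite (is_RInt_unique _ _ _ (- cos (a * (2 * PI)) / a - - cos (a * 0) / a)).
    + rewrite Hc, Rmult_0_r, cos_0. field; auto.
    + apply (is_RInt_derive (V := R_CompleteNormedModule) (fun t => - cos (a * t) / a)).
      * intros t _. auto_derive; [auto|field; auto].
      * intros t _. apply (continuous_comp (fun t => a * t) sin); [|apply continuous_sin].
        apply (continuous_scal_r (V := R_NormedModule) a (fun t => t)). apply continuous_id.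
Qed.

Lemma continuous_lin (a : R) t : continuous (fun t => a * t) t.
Proof. apply (continuous_scal_r (V := R_NormedModule) a (fun t => t)). apply continuous_id. Qed.

Lemma continuous_cis_lin (a : R) t : continuous (fun t => cis (a * t)) t.
Proof. apply (continuous_cis (fun t => a * t)), continuous_lin. Qed.

(** * Chain rule along a path *)

Lemma is_derive_eps (f : R -> R) x l : is_derive f x l <->
  forall eps, 0 < eps -> exists d, 0 < d /\ forall h, Rabs h < d ->
    Rabs (f (x + h) - f x - h * l) <= eps * Rabs h.
Proof.
  rewrite is_derive_Reals. split.
  - intros H eps Heps. destruct (H eps Heps) as [d Hd].
    exists d. split; [apply cond_pos|]. intros h Hh.
    destruct (Req_dec h 0) as [->|Hh0].
    + rewrite Rplus_0_r, Rmult_0_l, Rabs_R0. replace (f x - f x - 0) with 0 by ring.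
      rewrite Rabs_R0. lra.
    + specialize (Hd h Hh0 Hh).
      replace (f (x + h) - f x - h * l) with (((f (x + h) - f x) / h - l) * h) by (field; auto).
      rewrite Rabs_mult. apply Rmult_le_compat_r; [apply Rabs_pos|lra].
  - intros H eps Heps. destruct (H (eps / 2)) as [d [Hd0 Hd]]; [lra|].
    exists (mkposreal d Hd0). intros h Hh0 Hh. specialize (Hd h Hh).
    replace ((f (x + h) - f x) / h - l) with ((f (x + h) - f x - h * l) / h) by (field; auto).
    unfold Rdiv. rewrite Rabs_mult, Rabs_inv.
    assert (0 < Rabs h) by now apply Rabs_pos_lt.
    apply Rle_lt_trans with (eps / 2 * Rabs h * / Rabs h).
    + apply Rmult_le_compat_r; [|exact Hd]. left. now apply Rinv_0_lt_compat.
    + replace (eps / 2 * Rabs h * / Rabs h) with (eps / 2) by (field; lra). lra.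
Qed.

Lemma Cmod_le_abs (z : C) : Cmod z <= Rabs (fst z) + Rabs (snd z).
Proof.
  destruct z as [p q]. simpl.
  replace (p, q) with (RtoC p + RtoC q * Ci)%C.
  - eapply Rle_trans; [apply Cmod_triangle|].
    rewrite Cmod_mult, Cmod_Ci, !Cmod_R. lra.
  - unfold Cplus, Cmult, RtoC, Ci; simpl. apply injective_projections; simpl; ring.
Qed.

(** Chain rule for a holomorphic function along a path in the plane, stated for the
    two components since integrals are taken componentwise. *)
Lemma cderiv_path f (g : R -> C) t l g' : cderiv f (g t) l ->
  is_derive (fun t => fst (g t)) t (fst g') -> is_derive (fun t => snd (g t)) t (snd g') ->
  is_derive (fun t => fst (f (g t))) t (fst (l * g')%C) /\
  is_derive (fun t => snd (f (g t))) t (snd (l * g')%C).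
Proof.
  intros Hf H1 H2.
  assert (Hg : forall eps, 0 < eps -> exists d, 0 < d /\ forall h, Rabs h < d ->
    Cmod (g (t + h)%R - g t - h * g')%C <= eps * Rabs h).
  { intros eps Heps.
    destruct (proj1 (is_derive_eps _ _ _) H1 (eps / 2)) as [d1 [Hd1 HH1]]; [lra|].
    destruct (proj1 (is_derive_eps _ _ _) H2 (eps / 2)) as [d2 [Hd2 HH2]]; [lra|].
    exists (Rmin d1 d2). split; [now apply Rmin_pos|]. intros h Hh.
    eapply Rle_trans; [apply Cmod_le_abs|].
    specialize (HH1 h (Rlt_le_trans _ _ _ Hh (Rmin_l _ _))).
    specialize (HH2 h (Rlt_le_trans _ _ _ Hh (Rmin_r _ _))).
    simpl in *.
    match goal with |- Rabs ?a + Rabs ?b <= _ =>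
      replace a with (fst (g (t + h)) - fst (g t) - h * fst g') by ring;
      replace b with (snd (g (t + h)) - snd (g t) - h * snd g') by ring end.
    lra. }
  assert (P := Cmod_ge_0 g'). assert (Q := Cmod_ge_0 l).
  assert (HC : forall eps, 0 < eps -> exists d, 0 < d /\ forall h, Rabs h < d ->
    Cmod (f (g (t + h)%R) - f (g t) - h * (l * g'))%C <= eps * Rabs h).
  { intros eps Heps.
    (* [e1] controls the remainder of [f], whose increment is at most
       [(|g'| + 1) |h|]; [e2] controls the remainder of [g], multiplied by [l]. *)
    set (e1 := eps / (2 * (Cmod g' + 1))).
    set (e2 := Rmin 1 (eps / (2 * (Cmod l + 1)))).
    assert (He1 : 0 < e1) by (apply Rdiv_lt_0_compat; lra).
    assert (He2 : 0 < e2) by (apply Rmin_pos; [lra|apply Rdiv_lt_0_compat; lra]).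
    destruct (Hf e1 He1) as [d1 [Hd1 HH1]].
    destruct (Hg e2 He2) as [d2 [Hd2 HH2]].
    exists (Rmin d2 (d1 / (Cmod g' + 1))). split.
    { apply Rmin_pos; auto. apply Rdiv_lt_0_compat; lra. }
    intros h Hh.
    specialize (HH2 h (Rlt_le_trans _ _ _ Hh (Rmin_l _ _))).
    assert (Hh2 := Rlt_le_trans _ _ _ Hh (Rmin_r _ _)).
    set (k := (g (t + h)%R - g t)%C) in *.
    assert (Ph := Rabs_pos h).
    assert (E21 : e2 <= 1) by apply Rmin_l.
    assert (E22 : e2 * (Cmod l + 1) <= eps / 2).
    { apply Rle_trans with (eps / (2 * (Cmod l + 1)) * (Cmod l + 1)).
      - apply Rmult_le_compat_r; [lra|apply Rmin_r].
      - right. field. lra. }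
    assert (E1 : e1 * (Cmod g' + 1) = eps / 2) by (unfold e1; field; lra).
    assert (Hk : Cmod k <= (Cmod g' + 1) * Rabs h).
    { replace k with ((k - h * g') + h * g')%C by ring.
      eapply Rle_trans; [apply Cmod_triangle|]. rewrite Cmod_mult, Cmod_R. nra. }
    assert (Hk1 : Cmod k < d1).
    { eapply Rle_lt_trans; [exact Hk|].
      apply Rmult_lt_reg_r with (/ (Cmod g' + 1)); [apply Rinv_0_lt_compat; lra|].
      replace ((Cmod g' + 1) * Rabs h * / (Cmod g' + 1)) with (Rabs h) by (field; lra). exact Hh2. }
    specialize (HH1 k Hk1).
    replace (g t + k)%C with (g (t + h)%R) in HH1 by (unfold k; ring).
    replace (f (g (t + h)%R) - f (g t) - h * (l * g'))%C
    with ((f (g (t + h)%R) - f (g t) - l * k) + l * (k - h * g'))%C by ring.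
    eapply Rle_trans; [apply Cmod_triangle|]. rewrite Cmod_mult.
    assert (e1 * Cmod k <= eps / 2 * Rabs h) by (rewrite <- E1; nra).
    assert (Cmod l * Cmod (k - h * g')%C <= eps / 2 * Rabs h).
    { apply Rle_trans with (Cmod l * (e2 * Rabs h)).
      - now apply Rmult_le_compat_l.
      - nra. }
    lra. }
  split; apply is_derive_eps; intros eps Heps;
    destruct (HC eps Heps) as [d [Hd HH]]; exists d; split; auto; intros h Hh;
    (eapply Rle_trans; [|exact (HH h Hh)]).
  - eapply Rle_trans; [|apply Cmod_fst_le]. right. f_equal. simpl. ring.
  - eapply Rle_trans; [|apply Cmod_snd_le]. right. f_equal. simpl. ring.
Qed.

Lemma cderiv_scal f z l q : cderiv f z l -> cderiv (fun z => q * f z)%C z (q * l)%C.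
Proof.
  intros H eps Heps. assert (Q := Cmod_ge_0 q).
  destruct (H (eps / (Cmod q + 1))) as [d [Hd HH]]; [apply Rdiv_lt_0_compat; lra|].
  exists d. split; auto. intros h Hh. specialize (HH h Hh).
  replace (q * f (z + h) - q * f z - q * l * h)%C with (q * (f (z + h)%C - f z - l * h))%C by ring.
  rewrite Cmod_mult. eapply Rle_trans; [apply Rmult_le_compat_l; [auto|exact HH]|].
  assert (0 <= Cmod h) by apply Cmod_ge_0.
  replace (Cmod q * (eps / (Cmod q + 1) * Cmod h)) with (Cmod q / (Cmod q + 1) * (eps * Cmod h))
    by (field; lra).
  rewrite <- (Rmult_1_l (eps * Cmod h)) at 2. apply Rmult_le_compat_r; [nra|].
  apply Rmult_le_reg_r with (Cmod q + 1); [lra|].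
  unfold Rdiv. rewrite Rmult_assoc, Rinv_l by lra. lra.
Qed.

Lemma cderiv_continuous f z l : cderiv f z l -> continuous f z.
Proof.
  intros H P HP.
  assert (HPn : locally_norm (K := C_AbsRing) (V := C_NormedModule) (f z) P)
    by (apply locally_norm_le_locally; exact HP).
  destruct HPn as [eps Heps].
  destruct (H 1 Rlt_0_1) as [d [Hd HH]].
  assert (Q := Cmod_ge_0 l).
  set (d' := Rmin d (eps / (Cmod l + 2))).
  assert (Hd' : 0 < d').
  { apply Rmin_pos; auto. apply Rdiv_lt_0_compat; [apply cond_pos|lra]. }
  change (locally z (fun y => P (f y))).
  assert (X : forall y : C, Cmod (y - z)%C < d' -> P (f y)).
  2:{ generalize (locally_ball_norm (K := C_AbsRing) (V := C_NormedModule) z (mkposreal d' Hd')).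
      apply (filter_imp (F := locally z)). exact X. }
  intros y Hy.
  apply Heps. change (Cmod (f y - f z)%C < eps).
  specialize (HH (y - z)%C (Rlt_le_trans _ _ _ Hy (Rmin_l _ _))).
  replace (z + (y - z))%C with y in HH by ring.
  replace (f y - f z)%C with ((f y - f z - l * (y - z)) + l * (y - z))%C by ring.
  eapply Rle_lt_trans; [apply Cmod_triangle|]. rewrite Cmod_mult.
  assert (Hy2 := Rlt_le_trans _ _ _ Hy (Rmin_r _ _)).
  assert (Pe := cond_pos eps). assert (Py := Cmod_ge_0 (y - z)%C).
  assert (Cmod (y - z)%C * (Cmod l + 2) < eps).
  { apply Rmult_lt_reg_r with (/ (Cmod l + 2)); [apply Rinv_0_lt_compat; lra|].
    rewrite Rmult_assoc, Rinv_r by lra. rewrite Rmult_1_r. exact Hy2. }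
  nra.
Qed.

(** * Cauchy's formula *)

(** Allows an identity between complex integrals to be checked on real integrals
    only: the multiplier [c] commutes with the integral. *)
Lemma C_eq_of_Re_multiples (x y : C) : (forall c : C, fst (c * x)%C = fst (c * y)%C) -> x = y.
Proof.
  intros H. assert (H1 := H (RtoC 1)). assert (H2 := H Ci).
  destruct x as [a b], y as [c d]. simpl in *. apply injective_projections; simpl; lra.
Qed.

Lemma fst_CI_scal (c : C) F : (forall t, continuous F t) ->
  fst (c * CI F)%C = RInt (fun t => fst (c * F t)%C) 0 (2 * PI).
Proof. intros H. now rewrite <- CI_scal. Qed.

Lemma cis_2PI : cis (2 * PI) = RtoC 1.
Proof. rewrite <- (cis_2kPI 1). f_equal. simpl. ring. Qed.

Section Cauchy.
Variables (f f' : C -> C) (R0 r : R) (z : C).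
Hypothesis Hf : forall w, Cmod w < R0 -> cderiv f w (f' w).
Hypothesis Hf' : forall w, Cmod w < R0 -> continuous f' w.
Hypothesis Hz : Cmod z < r.
Hypothesis Hr : r < R0.

Let w (l t : R) : C := (z + l * (r * cis t - z))%C.
Let q (t : R) : C := (r * cis t / (r * cis t - z))%C.

Lemma outer_radius_pos : 0 < r.
Proof. eapply Rle_lt_trans; [apply Cmod_ge_0|exact Hz]. Qed.

Lemma Cmod_rcis t : Cmod (r * cis t)%C = r.
Proof. rewrite Cmod_mult, Cmod_cis, Cmod_R, Rabs_pos_eq; [ring|]. left; apply outer_radius_pos. Qed.

Lemma circle_minus_nz t : (r * cis t - z)%C <> RtoC 0.
Proof.
  intros E. assert (E' : (r * cis t)%C = z).
  { replace (r * cis t)%C with ((r * cis t - z) + z)%C by ring. rewrite E. ring. }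
  assert (P := Cmod_rcis t). rewrite E' in P. lra.
Qed.

Let eta := (R0 - r) / (2 * r).
Lemma eta_pos : 0 < eta.
Proof. apply Rdiv_lt_0_compat; [lra|]. assert (P := outer_radius_pos). lra. Qed.

(** The contraction stays in the disk for parameters slightly outside [0,1] too, as
    needed to differentiate at the end points. *)
Lemma homotopy_in_disk l0 l t : 0 <= l0 <= 1 -> Rabs (l - l0) < eta -> Cmod (w l t) < R0.
Proof.
  intros Hl0 Hl. assert (P := outer_radius_pos). assert (Q := Cmod_ge_0 z).
  unfold w. replace (z + l * (r * cis t - z))%C
    with ((RtoC (1 - l0)%R * z + l0 * (r * cis t)) + RtoC (l - l0)%R * (r * cis t - z))%C
    by (rewrite !RtoC_minus; ring).
  eapply Rle_lt_trans; [apply Cmod_triangle|].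
  assert (A1 : Cmod (RtoC (1 - l0)%R * z + l0 * (r * cis t))%C <= r).
  { eapply Rle_trans; [apply Cmod_triangle|].
    rewrite !(Cmod_mult (RtoC _) _), !Cmod_R, Cmod_cis, !Rabs_pos_eq by lra. nra. }
  assert (A2 : Cmod (RtoC (l - l0)%R * (r * cis t - z))%C <= Rabs (l - l0) * (2 * r)).
  { rewrite Cmod_mult, Cmod_R. apply Rmult_le_compat_l; [apply Rabs_pos|].
    eapply Rle_trans; [apply Cmod_triangle|]. rewrite Cmod_rcis, Cmod_opp. lra. }
  assert (A3 : Rabs (l - l0) * (2 * r) < eta * (2 * r)) by (apply Rmult_lt_compat_r; lra).
  replace (eta * (2 * r)) with (R0 - r) in A3 by (unfold eta; field; lra).
  lra.
Qed.

Lemma homotopy_in_disk_01 l t : 0 <= l <= 1 -> Cmod (w l t) < R0.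
Proof.
  intros H. apply (homotopy_in_disk l); auto. rewrite Rminus_diag, Rabs_R0. apply eta_pos.
Qed.

Lemma continuous_rcis t : continuous (fun t => r * cis t)%C t.
Proof.
  apply continuous_Cmult; [apply continuous_Cconst|].
  apply (continuous_cis (fun t => t)), continuous_id.
Qed.

Lemma continuous_cauchy_factor t : continuous q t.
Proof.
  unfold q, Cdiv. apply continuous_Cmult; [apply continuous_rcis|].
  apply continuous_Cinv; [|apply circle_minus_nz].
  apply continuous_Cminus; [apply continuous_rcis|apply continuous_Cconst].
Qed.

Lemma continuous_homotopy2 (p : R * R) :
  continuous (fun p : R * R => w (fst p) (snd p)) p.
Proof.
  unfold w. apply continuous_Cplus; [apply continuous_Cconst|].
  apply continuous_Cmult.
  - apply (continuous_RtoC (fun p : R * R => fst p)), continuous_fst_R2.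
  - apply continuous_Cminus; [|apply continuous_Cconst].
    apply continuous_Cmult; [apply continuous_Cconst|].
    apply (continuous_cis (fun p : R * R => snd p)), continuous_snd_R2.
Qed.

Lemma continuous_homotopy l t : continuous (fun t => w l t) t.
Proof.
  unfold w. apply continuous_Cplus; [apply continuous_Cconst|].
  apply continuous_Cmult; [apply continuous_Cconst|].
  apply continuous_Cminus; [|apply continuous_Cconst]. apply continuous_rcis.
Qed.

Lemma continuous_f_homotopy l0 l t : 0 <= l0 <= 1 -> Rabs (l - l0) < eta -> continuous (fun t =>
  f (w l t)) t.
Proof.
  intros H0 H. apply (continuous_comp (fun t => w l t) f); [apply continuous_homotopy|].
  eapply cderiv_continuous, Hf, homotopy_in_disk; eauto.
Qed.

(** The factor [r e^{it} - z] coming from the chain rule cancels the denominator of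
    the Cauchy kernel. *)
Lemma is_derive_homotopy c l0 l t : 0 <= l0 <= 1 -> Rabs (l - l0) < eta ->
  is_derive (fun l => fst (c * (q t * f (w l t)))%C) l (fst (c * (f' (w l t) * (r * cis t)))%C).
Proof.
  intros H0 H.
  assert (Hc := cderiv_scal _ _ _ (c * q t)%C (Hf _ (homotopy_in_disk l0 l t H0 H))).
  destruct (cderiv_path _ (fun l => w l t) l _ (r * cis t - z)%C Hc) as [D _].
  - unfold w; simpl. auto_derive; auto; ring.
  - unfold w; simpl. auto_derive; auto; ring.
  - replace (c * (f' (w l t) * (r * cis t)))%C with (c * q t * f' (w l t) * (r * cis t - z))%C.
    2:{ unfold q. field. apply circle_minus_nz. }
    revert D. apply (is_derive_ext (V := R_NormedModule)).
    intros x. now rewrite Cmult_assoc.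
Qed.

(** For [l <> 0] the integrand is a derivative in [t] of the periodic function
    [-i/l * f (w l t)]; for [l = 0] it is a multiple of [e^{it}]. *)
Lemma RInt_homotopy_derivative c l : 0 <= l <= 1 ->
  RInt (fun t => fst (c * (f' (w l t) * (r * cis t)))%C) 0 (2 * PI) = 0.
Proof.
  intros Hl. destruct (Req_dec l 0) as [->|Hl0].
  - rewrite (RInt_ext _ (fun t => fst (c * f' z * r * cis (1 * t))%C)).
    + rewrite <- fst_CI_scal by apply continuous_cis_lin.
      rewrite CI_cis_0; [simpl; ring|lra|]. rewrite Rmult_1_l. apply cis_2PI.
    + intros t _. apply f_equal. rewrite Rmult_1_l.
      assert (E : w 0 t = z) by (unfold w; ring); rewrite E;
        change (@eq C (c * (f' z * (r * cis t))) (c * f' z * r * cis t))%C. ring.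
  - set (k := (c * (- Ci / l))%C).
    assert (Hl0' : RtoC l <> RtoC 0) by (intros E; apply Hl0; now injection E).
    rewrite (is_RInt_unique _ _ _ (minus (fst (k * f (w l (2 * PI)))%C) (fst (k * f (w l 0))%C))).
    + unfold w. rewrite cis_2PI, cis_0. apply Rminus_diag.
    + apply (is_RInt_derive (V := R_CompleteNormedModule) (fun t => fst (k * f (w l t))%C)).
      * intros t _.
        assert (Hc := cderiv_scal _ _ _ k (Hf _ (homotopy_in_disk_01 l t Hl))).
        destruct (cderiv_path _ (fun t => w l t) t _ (l * (r * (Ci * cis t)))%C Hc) as [D _].
        -- unfold w; simpl. auto_derive; auto; ring.
        -- unfold w; simpl. auto_derive; auto; ring.
        -- replace (c * (f' (w l t) * (r * cis t)))%C with (k * f' (w l t) * (l * (r * (Ci * cis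
             t))))%C.
           ++ exact D.
           ++ unfold k. transitivity (- (Ci * Ci) * (c * (f' (w l t) * (r * cis t))))%C.
              ** field. auto.
              ** replace (Ci * Ci)%C with (-(1))%C; [ring|].
                 unfold Ci, Cmult, Copp, RtoC; simpl. apply injective_projections; simpl; ring.
      * intros t _. apply continuous_C_fst. apply continuous_Cmult; [apply continuous_Cconst|].
        apply continuous_Cmult; [|apply continuous_rcis].
        apply (continuous_comp (fun t => w l t) f'); [apply continuous_homotopy|].
        apply Hf', homotopy_in_disk_01, Hl.
Qed.

Lemma homotopy_integral_stationary c l0 : 0 <= l0 <= 1 ->
  is_derive (fun l => RInt (fun t => fst (c * (q t * f (w l t)))%C) 0 (2 * PI)) l0 0.
Proof.
  intros Hl0.
  cut (is_derive (fun l => RInt (fun t => fst (c * (q t * f (w l t)))%C) 0 (2 * PI)) l0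
        (RInt (fun t => fst (c * (f' (w l0 t) * (r * cis t)))%C) 0 (2 * PI))).
  { rewrite RInt_homotopy_derivative by exact Hl0. exact (fun D => D). }
  apply (is_derive_RInt_periodic (fun l t => fst (c * (q t * f (w l t)))%C)
    (fun l t => fst (c * (f' (w l t) * (r * cis t)))%C) l0 eta eta_pos).
  - intros u t Hu. now apply (is_derive_homotopy c l0).
  - intros u t Hu. apply continuous_C_fst.
    apply continuous_Cmult; [apply continuous_Cconst|].
    apply continuous_Cmult; [apply continuous_cauchy_factor|]. now apply (continuous_f_homotopy l0).
  - intros t.
    apply (continuous_C_fst
      (fun p : R * R => (c * (f' (w (fst p) (snd p)) * (r * cis (snd p))))%C)).
    apply continuous_Cmult; [apply continuous_Cconst|]. apply continuous_Cmult.
    + apply (continuous_comp (fun p : R * R => w (fst p) (snd p)) f');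
        [apply continuous_homotopy2|].
      apply Hf', homotopy_in_disk_01, Hl0.
    + apply continuous_Cmult; [apply continuous_Cconst|].
      apply (continuous_cis (fun p : R * R => snd p)), continuous_snd_R2.
Qed.

(** The integral of [q(t) f(w l t)] is the left side at [l = 1] and, [w 0 t] being
    [z], the right side at [l = 0]; its derivative in [l] vanishes. *)
Lemma cauchy_formula :
  CI (fun t => q t * f (r * cis t))%C = (f z * CI q)%C.
Proof.
  assert (C1 : forall t, continuous (fun t => q t * f (r * cis t))%C t).
  { intros t. apply continuous_Cmult; [apply continuous_cauchy_factor|].
    apply (continuous_comp (fun t => r * cis t)%C f); [apply continuous_rcis|].
    eapply cderiv_continuous, Hf. rewrite Cmod_rcis. exact Hr. }
  apply C_eq_of_Re_multiples. intros c. rewrite fst_CI_scal by exact C1.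
  rewrite Cmult_assoc, fst_CI_scal by apply continuous_cauchy_factor.
  assert (E := eq_is_derive (V := R_NormedModule) (fun l => RInt (fun t =>
    fst (c * (q t * f (w l t)))%C) 0 (2 * PI))
    0 1 (fun l Hl => homotopy_integral_stationary c l Hl) Rlt_0_1).
  cbv beta in E.
  transitivity (RInt (fun t => fst (c * (q t * f (w 1 t)))%C) 0 (2 * PI)).
  - apply RInt_ext. intros t _.
    assert (E1 : w 1 t = (r * cis t)%C) by (unfold w; ring). now rewrite E1.
  - etransitivity; [symmetry; exact E|]. apply RInt_ext. intros t _.
    assert (E1 : w 0 t = z) by (unfold w; ring). rewrite E1.
    assert (E2 : (c * (q t * f z) = c * f z * q t)%C) by ring. now rewrite E2.
Qed.
End Cauchy.

(** * Taylor expansions and Fourier coefficients *)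

Definition pseries_on (R0 : R) (a : nat -> C) (f : C -> C) : Prop :=
  forall z, Cmod z < R0 ->
    is_Cseries (fun k => a k * z ^ k)%C (f z).

Lemma one_minus_nz (x : C) : Cmod x < 1 -> (1 - x)%C <> RtoC 0.
Proof.
  intros H E. replace x with (RtoC 1) in H.
  - rewrite Cmod_1 in H. lra.
  - replace x with (1 - (1 - x))%C by ring. rewrite E. ring.
Qed.

Lemma is_Cseries_geom (x : C) : Cmod x < 1 ->
  is_Cseries (fun k => x ^ k)%C (/ (1 - x))%C.
Proof.
  intros Hx. assert (Hn := one_minus_nz x Hx).
  apply is_Cseries_eps. intros eps Heps.
  assert (Hm : 0 < Cmod (1 - x)%C) by now apply Cmod_gt_0.
  destruct (pow_lt_1_zero (Cmod x)) with (y := eps * Cmod (1 - x)%C) as [N HN].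
  { rewrite Rabs_pos_eq; [exact Hx|apply Cmod_ge_0]. }
  { apply Rmult_lt_0_compat; lra. }
  exists N. intros n Hnn. specialize (HN n Hnn).
  assert (E : forall n, (csum (fun k => x ^ k) n - / (1 - x) = - (x ^ n / (1 - x)))%C).
  { clear HN Hnn n. induction n as [|n IH]; simpl.
    - field. auto.
    - replace (csum (fun k => x ^ k) n + x ^ n - / (1 - x))%C
        with ((csum (fun k => x ^ k) n - / (1 - x)) + x ^ n)%C by ring.
      rewrite IH. field. auto. }
  rewrite E, Cmod_opp, Cmod_div, Cmod_pow by auto.
  apply Rmult_lt_reg_r with (Cmod (1 - x)%C); auto.
  unfold Rdiv. rewrite Rmult_assoc, Rinv_l by lra. rewrite Rmult_1_r.
  eapply Rle_lt_trans; [apply Rle_abs|exact HN].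
Qed.

Lemma ex_series_geom_abs (x : C) : Cmod x < 1 -> ex_series (fun k => Cmod (x ^ k)%C).
Proof.
  intros H. apply (ex_series_ext (V := R_NormedModule) (fun k => Cmod x ^ k)).
  - intros n. now rewrite Cmod_pow.
  - apply ex_series_geom. rewrite Rabs_pos_eq; [exact H|apply Cmod_ge_0].
Qed.

Lemma CI_cis_int a : cis (a * (2 * PI)) = RtoC 1 ->
  CI (fun t => cis (a * t)) = if Req_EM_T a 0 then RtoC (2 * PI) else RtoC 0.
Proof.
  intros H. destruct (Req_EM_T a 0) as [->|Ha].
  - rewrite (CI_ext _ (fun _ => RtoC 1)).
    + rewrite CI_const, RtoC_mult. ring.
    + intros t. now rewrite Rmult_0_l, cis_0.
  - now apply CI_cis_0.
Qed.

Lemma continuous_pseries a f R0 z : pseries_on R0 a f -> Cmod z < R0 -> continuous f z.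
Proof.
  intros H Hz. destruct (pseries_cderiv a f R0 H) as [f' Hf'].
  eapply cderiv_continuous, Hf', Hz.
Qed.

Lemma Cmod_scal_cis rho t : 0 <= rho -> Cmod (rho * cis t)%C = rho.
Proof. intros H. rewrite Cmod_mult, Cmod_cis, Cmod_R, Rabs_pos_eq; [ring|exact H]. Qed.

Lemma continuous_scal_cis (rho t : R) : continuous (fun t => rho * cis t)%C t.
Proof.
  apply continuous_Cmult; [apply continuous_Cconst|].
  apply (continuous_cis (fun t => t)), continuous_id.
Qed.

Lemma continuous_circle a f R0 rho t : pseries_on R0 a f -> 0 <= rho < R0 ->
  continuous (fun t => f (rho * cis t)%C) t.
Proof.
  intros H Hr. apply (continuous_comp (fun t => rho * cis t)%C f); [apply continuous_scal_cis|].
  eapply continuous_pseries; [exact H|]. rewrite Cmod_scal_cis; lra.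
Qed.

(** The form in which every pairing of [f] with a kernel on a circle is computed: it
    reduces to the Fourier coefficients of the kernel at nonpositive frequencies. *)
Lemma circle_pairing a f R0 rho K : pseries_on R0 a f -> 0 <= rho < R0 ->
  (forall t, continuous K t) ->
  is_Cseries
    (fun k => a k * rho ^ k * CI (fun t => cis (INR k * t) * K t))%C
    (CI (fun t => f (rho * cis t) * K t)%C).
Proof.
  intros H Hr HK.
  eapply is_Cseries_ext; [|apply (CI_series (fun k => a k * rho ^ k)%C cis)].
  - intros k. cbv beta. f_equal. apply CI_ext. intros t. now rewrite cis_pow.
  - apply (ex_series_ext (V := R_NormedModule) (fun k => Cmod (a k) * rho ^ k)).
    + intros n. rewrite Cmod_mult, Cmod_pow, Cmod_R, Rabs_pos_eq; [reflexivity|lra].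
    + eapply pseries_abs_conv; [exact H|lra].
  - intros t. apply (continuous_cis (fun t => t)), continuous_id.
  - intros t. rewrite Cmod_cis. lra.
  - intros t. eapply continuous_circle; eauto.
  - exact HK.
  - intros t. assert (Hz : Cmod (rho * cis t)%C < R0) by (rewrite Cmod_scal_cis; lra).
    eapply is_Cseries_ext; [|apply (H _ Hz)].
    intros k. cbv beta. rewrite Cpow_mult_l. ring.
Qed.

Lemma circle_coef a f R0 rho j : pseries_on R0 a f -> 0 <= rho < R0 ->
  CI (fun t => f (rho * cis t) * cis (- INR j * t))%C = (2 * PI * (a j * rho ^ j))%C.
Proof.
  intros H Hr.
  assert (P := circle_pairing a f R0 rho (fun t => cis (- INR j * t)) H Hr (fun t =>
    continuous_cis_lin _ t)).
  eapply is_Cseries_unique; [exact P|]. clear P.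
  assert (E : forall k, CI (fun t => cis (INR k * t) * cis (- INR j * t))%C
     = if Nat.eq_dec k j then RtoC (2 * PI) else RtoC 0).
  { intros k. rewrite (CI_ext _ (fun t => cis ((INR k - INR j) * t))).
    2:{ intros t. rewrite <- cis_plus. f_equal. ring. }
    rewrite CI_cis_int.
    - destruct (Req_EM_T _ _) as [Hr0|Hr0]; destruct (Nat.eq_dec k j) as [Hk|Hk]; auto; exfalso.
      + apply Hk, INR_eq. lra.
      + apply Hr0. subst. ring.
    - replace ((INR k - INR j) * (2 * PI)) with (INR k * (2 * PI) + - (INR j * (2 * PI))) by ring.
      rewrite cis_plus, cis_opp, !cis_2kPI. field. }
  replace (2 * PI * (a j * rho ^ j))%C
    with (a j * rho ^ j * CI (fun t => cis (INR j * t) * cis (- INR j * t)))%C.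
  - apply (is_Cseries_single (fun k => a k * rho ^ k * CI (fun t =>
      cis (INR k * t) * cis (- INR j * t)))%C).
    intros k Hk. rewrite E. destruct (Nat.eq_dec k j); [contradiction|]. ring.
  - rewrite E. destruct (Nat.eq_dec j j); [|contradiction]. rewrite RtoC_mult. ring.
Qed.

(** An analytic function has no negative frequencies. *)
Lemma circle_coef_pos a f R0 rho j : pseries_on R0 a f -> 0 <= rho < R0 ->
  CI (fun t => f (rho * cis t) * cis (INR (S j) * t))%C = RtoC 0.
Proof.
  intros H Hr.
  assert (P := circle_pairing a f R0 rho (fun t => cis (INR (S j) * t)) H Hr (fun t =>
    continuous_cis_lin _ t)).
  eapply is_Cseries_unique; [exact P|]. clear P.
  assert (E : forall k, CI (fun t => cis (INR k * t) * cis (INR (S j) * t))%C = RtoC 0).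
  { intros k. rewrite (CI_ext _ (fun t => cis (INR (k + S j) * t))).
    2:{ intros t. rewrite <- cis_plus, plus_INR. f_equal. ring. }
    apply CI_cis_0; [apply not_0_INR; lia|apply cis_2kPI]. }
  replace (RtoC 0) with (a O * rho ^ 0 * CI (fun t => cis (INR 0 * t) * cis (INR (S j) * t)))%C.
  - apply (is_Cseries_single (fun k => a k * rho ^ k * CI (fun t =>
      cis (INR k * t) * cis (INR (S j) * t)))%C).
    intros k Hk. rewrite E. ring.
  - rewrite E. ring.
Qed.

(** Both coefficients are the same Fourier coefficient on the circle of radius
    [R0/2]. *)
Lemma pseries_unique a b f R0 k : 0 < R0 -> pseries_on R0 a f -> pseries_on R0 b f -> a k = b k.
Proof.
  intros HR Ha Hb.
  assert (Hr : 0 <= R0 / 2 < R0) by lra.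
  assert (E : (2 * PI * (a k * RtoC (R0 / 2) ^ k) = 2 * PI * (b k * RtoC (R0 / 2) ^ k))%C).
  { rewrite <- (circle_coef a f R0 (R0 / 2)), <- (circle_coef b f R0 (R0 / 2)); auto. }
  assert (Hp : (RtoC (R0 / 2) ^ k)%C <> RtoC 0).
  { apply Cpow_nz. intros E0; injection E0; lra. }
  assert (HPI : RtoC PI <> RtoC 0).
  { assert (Q := PI_RGT_0). intros E0; injection E0; lra. }
  assert (H2 : RtoC 2 <> RtoC 0) by (intros E0; injection E0; lra).
  replace (a k) with (2 * PI * (a k * RtoC (R0 / 2) ^ k) / (2 * PI * RtoC (R0 / 2) ^ k))%C
    by (field; auto).
  rewrite E. field; auto.
Qed.

(** Expand both Cauchy integrals of [cauchy_formula] in powers of [z/r]; on the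
    right only the constant term survives and gives [2 pi]. *)
Lemma taylor_radius f f' R0 r :
  (forall w, Cmod w < R0 -> cderiv f w (f' w)) ->
  (forall w, Cmod w < R0 -> continuous f' w) ->
  0 < r < R0 -> exists a, pseries_on r a f.
Proof.
  intros Hf Hf' Hr.
  exists (fun k => CI (fun t => cis (- t) ^ k * f (r * cis t))%C / (2 * PI * r ^ k))%C.
  intros z Hz.
  assert (Hr0 : RtoC r <> RtoC 0) by (intros E; injection E; lra).
  assert (HPI : RtoC PI <> RtoC 0).
  { assert (Q := PI_RGT_0). intros E0; injection E0; lra. }
  assert (H2 : RtoC 2 <> RtoC 0) by (intros E0; injection E0; lra).
  set (x := (z / r)%C).
  assert (Hx : Cmod x < 1).
  { unfold x. rewrite Cmod_div, Cmod_R, Rabs_pos_eq by (auto; lra).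
    apply Rmult_lt_reg_r with r; [lra|]. unfold Rdiv. rewrite Rmult_assoc, Rinv_l by lra. lra. }
  set (q := fun t => (r * cis t / (r * cis t - z))%C).
  assert (Hcu : forall t, continuous (fun t => cis (- t)) t).
  { intros t. apply (continuous_cis (fun t => - t)).
    apply (continuous_opp (V := R_NormedModule)), continuous_id. }
  assert (Hu1 : forall t, Cmod (cis (- t)) <= 1) by (intros; rewrite Cmod_cis; lra).
  assert (Hcq : forall t, continuous q t) by (intros t; apply (continuous_cauchy_factor r z Hz)).
  assert (Hq : forall t, is_Cseries
     (fun k => x ^ k * cis (- t) ^ k)%C (q t)).
  { intros t. replace (q t) with (/ (1 - x * cis (- t)))%C.
    - eapply is_Cseries_ext; [|apply is_Cseries_geom].
      + intros k. cbv beta. now rewrite Cpow_mult_l.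
      + rewrite Cmod_mult, Cmod_cis. lra.
    - unfold q, x. rewrite cis_opp. field. repeat split; auto.
      + apply (circle_minus_nz r z); lra.
      + apply cis_nz. }
  assert (Hcf : forall t, continuous (fun t => f (r * cis t)%C) t).
  { intros t. apply (continuous_comp (fun t => r * cis t)%C f); [apply continuous_scal_cis|].
    eapply cderiv_continuous, Hf. rewrite Cmod_scal_cis; lra. }
  assert (CIq : CI q = (2 * PI)%C).
  { assert (S1 := CI_series (fun k => x ^ k)%C (fun t => cis (- t)) q (fun _ => RtoC 1)
      (ex_series_geom_abs x Hx) Hcu Hu1 Hcq (fun t => continuous_Cconst _ t) Hq).
    rewrite (CI_ext _ (fun t => q t * 1)%C) by (intros; ring).
    eapply is_Cseries_unique; [exact S1|].
    replace (2 * PI)%C with (x ^ 0 * CI (fun t => cis (- t) ^ 0 * 1))%C.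
    - apply (is_Cseries_single (fun k => x ^ k * CI (fun t => cis (- t) ^ k * 1))%C).
      intros [|k] Hk; [contradiction|].
      rewrite (CI_ext _ (fun t => cis (- INR (S k) * t))).
      + rewrite CI_cis_0; [ring| |].
        * assert (INR (S k) <> 0) by (apply not_0_INR; lia). lra.
        * replace (- INR (S k) * (2 * PI)) with (- (INR (S k) * (2 * PI))) by ring.
          rewrite cis_opp, cis_2kPI. field.
      + intros t. rewrite cis_pow. rewrite Cmult_1_r. f_equal. ring.
    - simpl. rewrite (CI_ext _ (fun _ => RtoC 1)) by (intros; ring). rewrite CI_const. ring. }
  assert (CF : CI (fun t => q t * f (r * cis t))%C = (f z * CI q)%C)
    by exact (cauchy_formula f f' R0 r z Hf Hf' Hz (proj2 Hr)).
  assert (S2 := CI_series (fun k => x ^ k)%C (fun t => cis (- t)) q (fun t => f (r * cis t)%C)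
      (ex_series_geom_abs x Hx) Hcu Hu1 Hcq Hcf Hq).
  cbv beta in S2. rewrite CF in S2.
  rewrite CIq in S2.
  apply (is_Cseries_scal (/ (2 * PI))%C) in S2.
  replace (f z) with (/ (2 * PI) * (f z * (2 * PI)))%C by (field; auto).
  eapply is_Cseries_ext; [|exact S2].
  intros k. cbv beta. assert (Ex : (x ^ k = z ^ k * / r ^ k)%C)
    by (unfold x, Cdiv; now rewrite Cpow_mult_l, Cpow_inv).
  rewrite Ex.
  field. repeat split; auto. now apply Cpow_nz.
Qed.

(** The expansions obtained on smaller circles agree by [pseries_unique], so that of
    radius [R0/2] represents [f] on the whole disk. *)
Lemma taylor f f' R0 :
  (forall w, Cmod w < R0 -> cderiv f w (f' w)) ->
  (forall w, Cmod w < R0 -> continuous f' w) ->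
  0 < R0 -> exists a, pseries_on R0 a f.
Proof.
  intros Hf Hf' HR.
  destruct (taylor_radius f f' R0 (R0 / 2) Hf Hf') as [a Ha]; [lra|].
  exists a. intros z Hz.
  assert (Q := Cmod_ge_0 z).
  set (r := Rmax ((Cmod z + R0) / 2) (R0 / 2)).
  assert (Hr1 : R0 / 2 <= r) by apply Rmax_r.
  assert (Hr2 : (Cmod z + R0) / 2 <= r) by apply Rmax_l.
  assert (Hr3 : r < R0) by (apply Rmax_lub_lt; lra).
  destruct (taylor_radius f f' R0 r Hf Hf') as [b Hb]; [lra|].
  eapply is_Cseries_ext; [|apply Hb; lra].
  intros k. cbv beta. f_equal. apply (pseries_unique b a f (R0 / 2)); [lra| |exact Ha].
  intros w Hw. apply Hb. lra.
Qed.

(** * Analytic functions on the disk and power series *)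

Lemma cderiv_C_derive f z l : cderiv f z l -> C_derive f z = l.
Proof.
  intros H. apply is_C_derive_unique. split.
  - apply is_linear_scal_l.
  - intros x Hx.
    assert (E : z = x) by (apply (is_filter_lim_locally_unique (K := C_AbsRing) (V :=
      AbsRing_NormedModule C_AbsRing)); exact Hx).
    subst x. intros eps. destruct (H eps (cond_pos eps)) as [d [Hd HH]].
    assert (X : forall y : C, Cmod (y - z)%C < d ->
      Cmod (f y - f z - (y - z) * l)%C <= eps * Cmod (y - z)%C).
    { intros y Hy. specialize (HH _ Hy). replace (z + (y - z))%C with y in HH by ring.
      now rewrite (Cmult_comm (y - z) l). }
    exists (mkposreal d Hd). exact X.
Qed.

Lemma cderiv_translate f w z l : cderiv (fun x => f (w + x)%C) z l <-> cderiv f (w + z)%C l.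
Proof.
  split; intros H eps Heps; destruct (H eps Heps) as [d [Hd HH]]; exists d; split; auto;
  intros h Hh; specialize (HH h Hh); revert HH; now rewrite Cplus_assoc.
Qed.

Lemma continuous_translate (f : C -> C) w z :
  continuous f (w + z)%C -> continuous (fun x => f (w + x)%C) z.
Proof.
  intros H. apply (continuous_comp (fun x => w + x)%C f); [|exact H].
  apply continuous_Cplus; [apply continuous_Cconst|apply continuous_id].
Qed.

Lemma pseries_holomorphic a f R0 : pseries_on R0 a f ->
  exists f', forall z, Cmod z < R0 -> cderiv f z (f' z) /\ continuous f' z.
Proof.
  intros H. destruct (pseries_cderiv a f R0 H) as [f' Hf'].
  exists f'. intros z Hz. split; [apply Hf', Hz|].
  apply (continuous_pseries (fun k => INR (S k) * a (S k))%C f' R0); [|exact Hz].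
  intros x Hx. apply Hf', Hx.
Qed.

(** Instead of rearranging the series around each centre, apply [taylor] to the
    translated function, which is holomorphic by [pseries_cderiv]. *)
Lemma pseries_on_analytic b g : pseries_on 1 b g -> analytic_on_disk g.
Proof.
  intros H w Hw. unfold in_disk in Hw.
  destruct (pseries_holomorphic b g 1 H) as [g' Hg'].
  assert (Hin : forall z, Cmod z < 1 - Cmod w -> Cmod (w + z)%C < 1).
  { intros z Hz. eapply Rle_lt_trans; [apply Cmod_triangle|]. lra. }
  destruct (taylor (fun z => g (w + z)%C) (fun z => g' (w + z)%C) (1 - Cmod w)) as [a Ha].
  - intros z Hz. apply cderiv_translate, Hg', Hin, Hz.
  - intros z Hz. apply continuous_translate, Hg', Hin, Hz.
  - lra.
  - exists a, (1 - Cmod w). split; [lra|]. intros z Hz. apply is_pseries_Cseries.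
    specialize (Ha _ Hz). cbv beta in Ha. replace (w + (z - w))%C with z in Ha by ring. exact Ha.
Qed.

(** The local expansions make [f] holomorphic with continuous derivative, and
    [C_derive] glues the local derivatives into one function. *)
Lemma analytic_pseries f : analytic_on_disk f -> exists a, pseries_on 1 a f.
Proof.
  intros H.
  assert (L : forall w, Cmod w < 1 -> cderiv f w (C_derive f w) /\ continuous (C_derive f) w).
  { intros w Hw. destruct (H w Hw) as [a [d [Hd Ha]]].
    assert (Hp : pseries_on d a (fun z => f (w + z)%C)).
    { intros z Hz. apply is_pseries_Cseries. specialize (Ha (w + z)%C).
      replace (w + z - w)%C with z in Ha by ring. now apply Ha. }
    destruct (pseries_holomorphic a _ d Hp) as [F' HF'].
    assert (Hall : forall z, Cmod z < d -> cderiv f (w + z)%C (F' z)).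
    { intros z Hz. apply cderiv_translate, HF', Hz. }
    assert (H0 : Cmod 0 < d) by (rewrite Cmod_0; exact Hd).
    assert (E0 : (w + 0)%C = w) by ring.
    split.
    - assert (D := Hall _ H0). rewrite E0 in D. now rewrite (cderiv_C_derive _ _ _ D).
    - apply (continuous_ext_loc (T := C_UniformSpace) (U := C_UniformSpace) (C_derive f) (fun y =>
        F' (- w + y)%C)).
      + generalize (locally_ball_norm (K := C_AbsRing) (V := C_NormedModule) w (mkposreal d Hd)).
        assert (X : forall y : C, Cmod (y - w)%C < d -> F' (- w + y)%C = C_derive f y).
        { intros y Hy. symmetry. replace y with (w + (- w + y))%C at 1 by ring.
          apply cderiv_C_derive, Hall. replace (- w + y)%C with (y - w)%C by ring. exact Hy. }
        apply (filter_imp (F := locally w)). exact X.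
      + apply continuous_translate. replace (- w + w)%C with (RtoC 0) by ring.
        apply HF', H0. }
  apply (taylor f (C_derive f) 1); [| |lra]; intros w Hw; apply L, Hw.
Qed.

(** * Blocks of the sine series *)

(** The sum of [sin(jt)/j] over [M < j <= M + l]. *)
Definition sine_block (M l : nat) (t : R) : R :=
  rsum (fun k => sin (INR (M + S k) * t) / INR (M + S k)) l.

Lemma continuous_rsum {U : UniformSpace} (F : nat -> U -> R) n x : (forall k, continuous (F k) x) ->
  continuous (fun u => rsum (fun k => F k u) n) x.
Proof.
  intros H. induction n as [|n IH]; simpl.
  - apply continuous_const.
  - now apply (continuous_plus (V := R_NormedModule)).
Qed.

Lemma continuous_sine_block M l t : continuous (sine_block M l) t.
Proof.
  unfold sine_block. apply (continuous_rsum (fun k t => sin (INR (M + S k) * t) / INR (M + S k))).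
  intros k. apply (continuous_mult (K := R_AbsRing)); [|apply continuous_const].
  apply (continuous_comp (fun t => INR (M + S k) * t) sin);
    [apply continuous_lin|apply continuous_sin].
Qed.

Lemma Rabs_sin_mult n t : Rabs (sin (INR n * t)) <= INR n * Rabs (sin t).
Proof.
  induction n as [|n IH].
  - simpl. rewrite Rmult_0_l, sin_0, Rabs_R0. lra.
  - rewrite S_INR. replace ((INR n + 1) * t) with (INR n * t + t) by ring.
    rewrite sin_plus. eapply Rle_trans; [apply Rabs_triang|]. rewrite !Rabs_mult.
    assert (B : forall x, Rabs (cos x) <= 1) by (intros; apply Rabs_le; destruct (COS_bound x);
      lra).
    assert (P := Rabs_pos (sin (INR n * t))). assert (Q := Rabs_pos (sin t)).
    assert (B1 := B t). assert (B2 := B (INR n * t)).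
    nra.
Qed.

Lemma sin_half_nonneg t : 0 <= t <= 2 * PI -> 0 <= sin (t / 2).
Proof. intros H. apply sin_ge_0; lra. Qed.

(** Each term is at most [|sin t| <= 2 sin(t/2)] in modulus. *)
Lemma sine_block_near_zero M l t : 0 <= t <= 2 * PI -> Rabs (sine_block M l t)
  <= 2 * INR l * sin (t / 2).
Proof.
  intros Ht. assert (S := sin_half_nonneg t Ht). unfold sine_block.
  induction l as [|l IH]; simpl rsum.
  - rewrite Rabs_R0. simpl. lra.
  - eapply Rle_trans; [apply Rabs_triang|]. rewrite S_INR.
    assert (B : Rabs (sin (INR (M + Datatypes.S l) * t) / INR (M + Datatypes.S l))
      <= 2 * sin (t / 2)).
    { assert (Hp : 0 < INR (M + Datatypes.S l)) by (apply lt_0_INR; lia).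
      unfold Rdiv. rewrite Rabs_mult, (Rabs_pos_eq (/ _)) by (left; now apply Rinv_0_lt_compat).
      apply Rmult_le_reg_r with (INR (M + Datatypes.S l)); auto.
      rewrite Rmult_assoc, Rinv_l, Rmult_1_r by lra.
      eapply Rle_trans; [apply Rabs_sin_mult|].
      rewrite Rmult_comm. apply Rmult_le_compat_r; [lra|].
      replace t with (2 * (t / 2)) at 1 by field. rewrite sin_2a, !Rabs_mult.
      rewrite (Rabs_pos_eq 2), (Rabs_pos_eq (sin _)) by lra.
      assert (C : Rabs (cos (t / 2)) <= 1) by (apply Rabs_le; destruct (COS_bound (t / 2)); lra).
      nra. }
    lra.
Qed.

(** Summation by parts: [2 sin(t/2) sin(jt)] is the difference of two consecutive
    values of [cos((j - 1/2)t)], and the weights [1/j] decrease. *)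
Lemma sine_block_far M l t : Rabs (sin (t / 2) * sine_block M l t) <= / INR (S M).
Proof.
  assert (Hp : forall k, 0 < INR (S k)) by (intros; apply lt_0_INR; lia).
  (* Keeping the boundary term of the summation by parts on the left makes the
     induction telescope. *)
  assert (K : Rabs (2 * sin (t / 2) * sine_block M l t
                 + cos ((INR (M + l) + / 2) * t) / INR (S (M + l)))
          <= 2 / INR (S M) - / INR (S (M + l))).
  { unfold sine_block. induction l as [|l IH]; simpl rsum.
    - rewrite Nat.add_0_r. rewrite Rmult_0_r, Rplus_0_l.
      unfold Rdiv. rewrite Rabs_mult, (Rabs_pos_eq (/ _)) by (left; apply Rinv_0_lt_compat, Hp).
      assert (C : Rabs (cos ((INR M + / 2) * t)) <= 1) by (apply Rabs_le;
        destruct (COS_bound ((INR M + / 2) * t)); lra).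
      assert (I := Rinv_0_lt_compat _ (Hp M)). nra.
    - rewrite !Nat.add_succ_r. set (m := (M + l)%nat) in *.
      set (s := rsum _ l) in *.
      set (Cm := cos ((INR m + / 2) * t)) in *. set (Cm1 := cos ((INR (S m) + / 2) * t)) in *.
      assert (E : 2 * sin (t / 2) * sin (INR (S m) * t) = Cm - Cm1).
      { unfold Cm, Cm1.
        replace ((INR m + / 2) * t) with (INR (S m) * t - t / 2) by (rewrite S_INR; field).
        replace ((INR (S m) + / 2) * t) with (INR (S m) * t + t / 2) by field.
        rewrite cos_minus, cos_plus. ring. }
      assert (C : Rabs Cm1 <= 1) by (apply Rabs_le; destruct (COS_bound ((INR (S m) + / 2) * t));
        unfold Cm1; lra).
      assert (I1 := Rinv_0_lt_compat _ (Hp m)). assert (I2 := Rinv_0_lt_compat _ (Hp (S m))).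
      assert (I3 : / INR (S (S m)) <= / INR (S m)).
      { apply Rinv_le_contravar; [apply Hp|]. apply le_INR. lia. }
      replace (2 * sin (t / 2) * (s + sin (INR (S m) * t) / INR (S m)) + Cm1 / INR (S (S m)))
      with ((2 * sin (t / 2) * s + Cm / INR (S m)) + - (Cm1 * (/ INR (S m) - / INR (S (S m))))).
      2:{ assert (E2 : 2 * sin (t / 2) * (s + sin (INR (S m) * t) / INR (S m))
            = 2 * sin (t / 2) * s + (Cm - Cm1) / INR (S m)).
          { rewrite <- E. unfold Rdiv. ring. }
          rewrite E2. unfold Rdiv. ring. }
      eapply Rle_trans; [apply Rabs_triang|]. rewrite Rabs_Ropp, Rabs_mult.
      rewrite (Rabs_pos_eq (/ INR (S m) - / INR (S (S m)))) by lra.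
      nra. }
  assert (I := Rinv_0_lt_compat _ (Hp (M + l)%nat)).
  set (c := cos ((INR (M + l) + / 2) * t)) in *.
  assert (C : Rabs (c / INR (S (M + l))) <= / INR (S (M + l))).
  { unfold Rdiv. rewrite Rabs_mult, (Rabs_pos_eq (/ _)) by lra.
    assert (Rabs c <= 1) by (apply Rabs_le; destruct (COS_bound ((INR (M + l) + / 2) * t));
      unfold c; lra).
    nra. }
  unfold Rdiv at 2 in K.
  apply Rabs_le. apply Rabs_le_between in K. apply Rabs_le_between in C.
  split; nra.
Qed.

Lemma sine_block_split M l l' t : sine_block M (l + l') t = sine_block M l t + sine_block (M + l)
  l' t.
Proof.
  induction l' as [|l' IH].
  - rewrite Nat.add_0_r. unfold sine_block. simpl. ring.
  - rewrite Nat.add_succ_r. unfold sine_block in *. simpl rsum. rewrite IH.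
    replace (M + l + S l')%nat with (M + S (l + l'))%nat by lia. ring.
Qed.

(** Cut the block after about [1/sin(t/2)] terms and use [sine_block_near_zero] on
    the first part, [sine_block_far] on the second. *)
Lemma sine_block_bounded M l t : 0 <= t <= 2 * PI -> Rabs (sine_block M l t) <= 3.
Proof.
  intros Ht. assert (Hs := sin_half_nonneg t Ht). set (s := sin (t / 2)) in *.
  destruct (Req_dec s 0) as [Hs0|Hs0].
  { assert (P := sine_block_near_zero M l t Ht). fold s in P. rewrite Hs0 in P. lra. }
  assert (Hs' : 0 < s) by lra.

  (* [J] is the cutting point: [J s <= 1 <= (J + 1) s]. *)
  destruct (nfloor_ex (/ s)) as [J [HJ1 HJ2]]; [left; now apply Rinv_0_lt_compat|].
  assert (HJa : INR J * s <= 1).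
  { apply Rmult_le_reg_r with (/ s); [now apply Rinv_0_lt_compat|].
    rewrite Rmult_assoc, Rinv_r, Rmult_1_r, Rmult_1_l by lra. exact HJ1. }
  assert (HJb : 1 <= INR (S J) * s).
  { rewrite S_INR. apply Rmult_le_reg_r with (/ s); [now apply Rinv_0_lt_compat|].
    rewrite Rmult_assoc, Rinv_r, Rmult_1_r, Rmult_1_l by lra. lra. }
  assert (Far : forall M' l', (J <= M')%nat -> Rabs (sine_block M' l' t) <= 1).
  { intros M' l' HM. assert (P := sine_block_far M' l' t). fold s in P.
    rewrite Rabs_mult, (Rabs_pos_eq s) in P by lra.
    assert (Q : INR (S J) <= INR (S M')) by (apply le_INR; lia).
    assert (Hp : 0 < INR (S M')) by (apply lt_0_INR; lia).
    assert (R1 : / INR (S M') <= s).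
    { apply Rmult_le_reg_r with (INR (S M')); auto. rewrite Rinv_l by lra. nra. }
    apply Rmult_le_reg_l with s; lra. }
  assert (Near : forall M' l', (l' <= J)%nat -> Rabs (sine_block M' l' t) <= 2).
  { intros M' l' Hl. assert (P := sine_block_near_zero M' l' t Ht). fold s in P.
    assert (Q := le_INR _ _ Hl). nra. }
  destruct (Nat.le_gt_cases l J) as [Hl|Hl].
  - specialize (Near M l Hl). lra.
  - replace l with (J + (l - J))%nat by lia. rewrite sine_block_split.
    eapply Rle_trans; [apply Rabs_triang|].
    assert (N := Near M J (le_n _)). assert (F := Far (M + J)%nat (l - J)%nat ltac:(lia)). lra.
Qed.

(** * Integral means and Taylor coefficients *)

Lemma rcis_pair r t : (r * cos t, r * sin t) = (r * cis t)%C.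
Proof. unfold cis, Cmult, RtoC; simpl. apply injective_projections; simpl; ring. Qed.

Definition circle_abs (f : C -> C) (r t : R) : R := Cmod (f (r * cis t)%C).

Lemma M1_circle_abs r f : M1 r f = / (2 * PI) * RInt (circle_abs f r) 0 (2 * PI).
Proof.
  unfold M1. f_equal. apply RInt_ext. intros t _. unfold circle_abs. now rewrite rcis_pair.
Qed.

Lemma circle_abs_nonneg f r t : 0 <= circle_abs f r t.
Proof. apply Cmod_ge_0. Qed.

Lemma continuous_circle_abs a f r t : pseries_on 1 a f -> 0 <= r < 1 ->
  continuous (circle_abs f r) t.
Proof. intros H Hr. apply continuous_Cmod. eapply continuous_circle; eauto. Qed.

Lemma RInt_circle_abs_bounds a f A r : pseries_on 1 a f -> 0 <= r < 1 -> M1 r f <= A ->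
  0 <= RInt (circle_abs f r) 0 (2 * PI) <= 2 * PI * A.
Proof.
  intros H Hr HA. assert (P := PI_RGT_0).
  split.
  - apply RInt_ge_0; [lra| |].
    + apply ex_RInt_cont. intros; eapply continuous_circle_abs; eauto.
    + intros; apply circle_abs_nonneg.
  - rewrite M1_circle_abs in HA. apply Rmult_le_reg_l with (/ (2 * PI)); [apply Rinv_0_lt_compat;
      lra|].
    rewrite <- Rmult_assoc, Rinv_l by lra. lra.
Qed.

Lemma Cmod_2PI (x : C) : Cmod (2 * PI * x)%C = 2 * PI * Cmod x.
Proof.
  assert (P := PI_RGT_0). rewrite !Cmod_mult, !Cmod_R, !Rabs_pos_eq; lra.
Qed.

Lemma coef_bound_at_radius a f A r j : pseries_on 1 a f -> 0 <= r < 1 -> M1 r f <= A ->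
  Cmod (a j) * r ^ j <= A.
Proof.
  intros H Hr HA. assert (P := PI_RGT_0).
  assert (E := circle_coef a f 1 r j H Hr).
  assert (B : Cmod (CI (fun t => f (r * cis t) * cis (- INR j * t))%C)
    <= RInt (circle_abs f r) 0 (2 * PI)).
  { apply CI_norm.
    - intros t. apply continuous_Cmult; [eapply continuous_circle; eauto|apply continuous_cis_lin].
    - intros t. eapply continuous_circle_abs; eauto.
    - intros t _. rewrite Cmod_mult, Cmod_cis. unfold circle_abs. lra. }
  rewrite E, Cmod_2PI, Cmod_mult, Cmod_pow, Cmod_R, Rabs_pos_eq in B by lra.
  assert (Q := proj2 (RInt_circle_abs_bounds a f A r H Hr HA)). nra.
Qed.

Lemma pow_ge_lin r k : 0 <= r <= 1 -> 1 - INR k * (1 - r) <= r ^ k.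
Proof.
  intros Hr. induction k as [|k IH]; [simpl; lra|].
  rewrite S_INR. simpl pow.
  assert (0 <= r ^ k <= 1) by (split; [apply pow_le; lra|rewrite <- (pow1 k); apply pow_incr; lra]).
  nra.
Qed.

(** Let the radius tend to 1 in [coef_bound_at_radius]. *)
Lemma coef_bound a f A j : pseries_on 1 a f -> (forall r, 0 <= r < 1 -> M1 r f <= A) ->
  Cmod (a j) <= A.
Proof.
  intros H HA. apply le_epsilon. intros eps Heps.
  set (c := Cmod (a j)). assert (Hc : 0 <= c) by apply Cmod_ge_0.
  assert (Hj := pos_INR j).
  set (x := Rmin 1 (eps / (c * INR j + 1))).
  assert (Hx0 : 0 < x) by (apply Rmin_pos; [lra|apply Rdiv_lt_0_compat; nra]).
  assert (Hx1 : x <= 1) by apply Rmin_l.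
  assert (Hx2 : x * (c * INR j + 1) <= eps).
  { apply Rle_trans with (eps / (c * INR j + 1) * (c * INR j + 1)).
    - apply Rmult_le_compat_r; [nra|apply Rmin_r].
    - right. field. nra. }
  assert (Hr : 0 <= 1 - x < 1) by lra.
  assert (B := coef_bound_at_radius a f A (1 - x) j H Hr (HA _ Hr)). fold c in B.
  assert (L := pow_ge_lin (1 - x) j ltac:(lra)).
  replace (1 - (1 - x)) with x in L by ring.
  nra.
Qed.

(** As [-2i sin(jt) = e^{-ijt} - e^{ijt}], each term of the sine block picks one
    Taylor coefficient through [e^{-ijt}]; the other exponential has positive
    frequency and is orthogonal to [f].  Using sines rather than the exponentials
    [e^{-ijt}] alone is what makes the kernel bounded. *)
Lemma sine_block_pairing a f r n m l : pseries_on 1 a f -> 0 <= r < 1 ->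
  CI (fun t => f (r * cis t) * (- 2 * Ci * cis (INR (S n) * t) * sine_block (n + m) l t))%C =
  (2 * PI * csum (fun k => a (m + k)%nat * r ^ (m + k) / INR (n + (m + k) + 1)) l)%C.
Proof.
  intros H Hr.
  assert (Hc : forall t, continuous (fun t => f (r * cis t)%C) t) by (intros;
    eapply continuous_circle; eauto).
  set (K := fun l t => (- 2 * Ci * cis (INR (S n) * t) * sine_block (n + m) l t)%C).
  assert (HK : forall l t, continuous (K l) t).
  { intros l0 t. unfold K. apply continuous_Cmult.
    - apply continuous_Cmult; [apply continuous_Cconst|apply continuous_cis_lin].
    - apply (continuous_RtoC (sine_block (n + m) l0)), continuous_sine_block. }
  change (CI (fun t => f (r * cis t) * K l t)%C =
   (2 * PI * csum (fun k => a (m + k)%nat * r ^ (m + k) / INR (n + (m + k) + 1)) l)%C).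
  induction l as [|l IH].
  - rewrite (CI_ext _ (fun _ => RtoC 0)).
    + rewrite CI_const. simpl. ring.
    + intros t. unfold K, sine_block. simpl. ring.
  - simpl csum. set (j := (n + m + S l)%nat).
    assert (Hj : INR j <> 0) by (apply not_0_INR; unfold j; lia).
    assert (HjC : RtoC (INR j) <> RtoC 0) by (intros E; apply Hj; now injection E).
    rewrite (CI_ext _ (fun t => f (r * cis t) * K l t +
       / INR j * (f (r * cis t) * cis (- INR (m + l) * t)
                - f (r * cis t) * cis (INR (S (n + j)) * t)))%C).
    + rewrite CI_plus.
      * rewrite CI_scal, CI_minus.
        -- rewrite IH, (circle_coef a f 1 r) by auto.
           rewrite (circle_coef_pos a f 1 r) by auto.
           replace (n + (m + l) + 1)%nat with j by (unfold j; lia). field. auto.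
        -- intros t. apply continuous_Cmult; auto. apply continuous_cis_lin.
        -- intros t. apply continuous_Cmult; auto. apply continuous_cis_lin.
        -- intros t. apply continuous_Cminus; apply continuous_Cmult; auto;
             apply continuous_cis_lin.
      * intros t. apply continuous_Cmult; auto.
      * intros t. apply continuous_Cmult; [apply continuous_Cconst|].
        apply continuous_Cminus; apply continuous_Cmult; auto; apply continuous_cis_lin.
    + intros t. unfold K, sine_block. simpl rsum. fold j.
      replace (- INR (m + l) * t) with (INR (S n) * t + - (INR j * t)).
      2:{ unfold j. rewrite !plus_INR, !S_INR. ring. }
      replace (INR (S (n + j)) * t) with (INR (S n) * t + INR j * t).
      2:{ rewrite !S_INR, !plus_INR. ring. }
      rewrite !cis_plus.
      assert (E : (cis (- (INR j * t)) - cis (INR j * t) = - 2 * Ci * sin (INR j * t))%C).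
      { unfold cis, Cminus, Cplus, Copp, Cmult, Ci, RtoC; simpl. rewrite cos_neg, sin_neg.
        apply injective_projections; simpl; ring. }
      rewrite RtoC_plus, (RtoC_div _ _ Hj).
      replace (f (r * cis t) * (cis (INR (S n) * t) * cis (- (INR j * t)))
         - f (r * cis t) * (cis (INR (S n) * t) * cis (INR j * t)))%C
      with (f (r * cis t) * cis (INR (S n) * t) * (cis (- (INR j * t)) - cis (INR j * t)))%C
        by ring.
      rewrite E. field. auto.
Qed.

(** * Convergence of the coefficients of the image *)

(** Otherwise [J 0 i] would drop by [eps] at each of an increasing sequence of levels
    for all large [i]; after more than [B/eps] drops this contradicts the bounds on
    [J].  Below, [J p i] is the mass of [|f|] on the [i]-th circle seen through the
    [p]-th weight. *)
Lemma exists_persistent_level (J : nat -> nat -> R) B eps :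
  (forall n i, 0 <= J n i <= B) -> 0 < eps ->
  exists n, forall m, (n <= m)%nat -> forall i0, exists i, (i0 <= i)%nat /\ J n i - J m i <= eps.
Proof.
  intros HJ Heps. apply NNPP. intros Hno.
  assert (H1 : forall n, exists m i0, forall i, (i0 <= i)%nat -> eps < J n i - J m i).
  { intros n. apply NNPP. intros Hn. apply Hno. exists n. intros m Hm i0.
    apply NNPP. intros Hi. apply Hn. exists m, i0. intros i Hii.
    apply Rnot_le_lt. intros Hle. apply Hi. now exists i. }
  assert (H2 : forall K, exists m i0, forall i, (i0 <= i)%nat -> INR K * eps <= J O i - J m i).
  { induction K as [|K [m [i0 IH]]].
    - exists O, O. intros i _. simpl. lra.
    - destruct (H1 m) as [m' [i1 H1']]. exists m', (max i0 i1). intros i Hi.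
      specialize (IH i ltac:(lia)). specialize (H1' i ltac:(lia)). rewrite S_INR. lra. }
  destruct (INR_archimed eps (B + 1) Heps) as [K HK].
  destruct (H2 K) as [m [i0 Hm]]. specialize (Hm i0 (le_n _)).
  assert (X := HJ O i0). assert (Y := HJ m i0). lra.
Qed.

(** A bump at [t = 0] (modulo the period) of width about [1/sqrt p]; the difference
    of two such bumps is a smooth substitute for the indicator of a ring around 0. *)
Definition weight (p : nat) (t : R) : R := / (1 + INR p * (sin (t / 2) * sin (t / 2))).

Lemma weight_den_pos p t : 0 < 1 + INR p * (sin (t / 2) * sin (t / 2)).
Proof. assert (P := pos_INR p). assert (0 <= sin (t / 2) * sin (t / 2)) by nra. nra. Qed.

Lemma weight_bounds p t : 0 <= weight p t <= 1.
Proof.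
  assert (D := weight_den_pos p t). unfold weight. split.
  - left. now apply Rinv_0_lt_compat.
  - rewrite <- Rinv_1. apply Rinv_le_contravar; [lra|].
    assert (P := pos_INR p). assert (0 <= sin (t / 2) * sin (t / 2)) by nra. nra.
Qed.

Lemma weight_decr p q t : (p <= q)%nat -> weight q t <= weight p t.
Proof.
  intros H. apply Rinv_le_contravar; [apply weight_den_pos|].
  assert (P := le_INR _ _ H). assert (0 <= sin (t / 2) * sin (t / 2)) by nra. nra.
Qed.

Lemma continuous_weight p t : continuous (weight p) t.
Proof.
  assert (D := weight_den_pos p t).
  apply (ex_derive_continuous (V := R_NormedModule)). unfold weight. auto_derive. lra.
Qed.

(** A fixed sequence increasing to 1, along which all radial limits are taken. *)
Definition radii (i : nat) : R := 1 - / (INR i + 1).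

Lemma radii_bounds i : 0 <= radii i < 1.
Proof.
  assert (P := pos_INR i). unfold radii.
  assert (0 < / (INR i + 1)) by (apply Rinv_0_lt_compat; lra).
  assert (/ (INR i + 1) <= 1) by (rewrite <- Rinv_1; apply Rinv_le_contravar; lra). lra.
Qed.

(** Three regions: for [sin(t/2) <= eta] the block is at most [2 l eta], for
    [sin(t/2) > delta] it is at most [1/((M+1) delta)], and in between it is at most
    3 while the two weights differ by at least [1/2]. *)
Lemma sine_block_le_weights M l p q delta eta t :
  0 <= t <= 2 * PI -> 0 < delta -> 0 < eta -> (p <= q)%nat ->
  3 * INR p * (delta * delta) <= 1 -> 3 <= INR q * (eta * eta) ->
  2 * Rabs (sine_block M l t) <= 12 * (weight p t - weight q t) + 2 / (INR (S M) * delta) + 4 *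
    INR l * eta.
Proof.
  intros Ht Hd He Hpq Hp Hq.
  assert (Hs := sin_half_nonneg t Ht). set (s := sin (t / 2)) in *.
  assert (W := weight_decr p q t Hpq). assert (Hl := pos_INR l).
  assert (HM : 0 < INR (S M)) by (apply lt_0_INR; lia).
  assert (HMd : 0 < / (INR (S M) * delta)) by (apply Rinv_0_lt_compat, Rmult_lt_0_compat; lra).
  assert (Hle : 0 <= INR l * eta) by nra.
  destruct (Rle_dec s eta) as [Hse|Hse].
  - assert (P := sine_block_near_zero M l t Ht). fold s in P. unfold Rdiv. nra.
  - destruct (Rle_dec s delta) as [Hsd|Hsd].
    + assert (P := sine_block_bounded M l t Ht).
      assert (D1 := weight_den_pos p t). assert (D2 := weight_den_pos q t). fold s in D1, D2.
      assert (W1 : 3 / 4 <= weight p t).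
      { unfold weight. fold s. apply Rmult_le_reg_r with (1 + INR p * (s * s)); auto.
        rewrite Rinv_l by lra. assert (s * s <= delta * delta) by nra.
        assert (0 <= INR p) by apply pos_INR. nra. }
      assert (W2 : weight q t <= 1 / 4).
      { unfold weight. fold s. apply Rmult_le_reg_r with (1 + INR q * (s * s)); auto.
        rewrite Rinv_l by lra. assert (eta * eta <= s * s) by nra.
        assert (0 <= INR q) by apply pos_INR. nra. }
      unfold Rdiv. lra.
    + assert (P := sine_block_far M l t). fold s in P.
      rewrite Rabs_mult, (Rabs_pos_eq s) in P by lra.
      assert (Q : Rabs (sine_block M l t) <= / (INR (S M) * delta)).
      { rewrite Rinv_mult. apply Rmult_le_reg_l with delta; auto.
        replace (delta * (/ INR (S M) * / delta)) with (/ INR (S M)) by (field; lra).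
        eapply Rle_trans; [|exact P]. apply Rmult_le_compat_r; [apply Rabs_pos|lra]. }
      unfold Rdiv. lra.
Qed.

Section Convergence.
Variables (a : nat -> C) (f : C -> C) (A : R).
Hypothesis Hp : pseries_on 1 a f.
Hypothesis HA : forall r, 0 <= r < 1 -> M1 r f <= A.

Lemma mean_bound_nonneg : 0 <= A.
Proof. eapply Rle_trans; [apply Cmod_ge_0|apply (coef_bound a f A O Hp HA)]. Qed.

Let J (p i : nat) : R := RInt (fun t => circle_abs f (radii i) t * weight p t) 0 (2 * PI).

Lemma continuous_J p i t : continuous (fun t => circle_abs f (radii i) t * weight p t) t.
Proof.
  apply (continuous_mult (K := R_AbsRing)).
  - eapply continuous_circle_abs; eauto. apply radii_bounds.
  - apply continuous_weight.
Qed.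

Lemma J_bounds p i : 0 <= J p i <= 2 * PI * A.
Proof.
  assert (P := PI_RGT_0). split.
  - apply RInt_ge_0; [lra| |].
    + apply ex_RInt_cont, continuous_J.
    + intros t _. apply Rmult_le_pos; [apply circle_abs_nonneg|apply weight_bounds].
  - eapply Rle_trans; [|apply (RInt_circle_abs_bounds a f A (radii i) Hp (radii_bounds i) (HA _
      (radii_bounds i)))].
    apply RInt_cont_le.
    + apply continuous_J.
    + intros t; eapply continuous_circle_abs; eauto. apply radii_bounds.
    + intros t _. assert (Q := circle_abs_nonneg f (radii i) t). assert (W := weight_bounds p t).
      nra.
Qed.

Lemma coef_block_on_circle n m l p q delta eta i :
  0 < delta -> 0 < eta -> (p <= q)%nat ->
  3 * INR p * (delta * delta) <= 1 -> 3 <= INR q * (eta * eta) ->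
  2 * PI * Cmod (csum (fun k => a (m + k)%nat * radii i ^ (m + k) / INR (n + (m + k) + 1)) l)%C
  <= 12 * (J p i - J q i) + (2 / (INR (S (n + m)) * delta) + 4 * INR l * eta) * (2 * PI * A).
Proof.
  intros Hd He Hpq H1 H2.
  assert (Hc : forall t, continuous (circle_abs f (radii i)) t)
    by (intros t; eapply continuous_circle_abs; eauto; apply radii_bounds).
  set (D := 2 / (INR (S (n + m)) * delta) + 4 * INR l * eta).
  assert (HD : 0 <= D).
  { unfold D. assert (0 < INR (S (n + m))) by (apply lt_0_INR; lia).
    assert (0 < / (INR (S (n + m)) * delta)) by (apply Rinv_0_lt_compat, Rmult_lt_0_compat; lra).
    assert (Hl := pos_INR l). unfold Rdiv. nra. }
  rewrite <- Cmod_2PI, <- (sine_block_pairing a f (radii i) n m l Hp (radii_bounds i)).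
  eapply Rle_trans.
  - apply (CI_norm _ (fun t => 12 * (circle_abs f (radii i) t * weight p t)
       + 1 * ((-12) * (circle_abs f (radii i) t * weight q t) + D * circle_abs f (radii i) t))).
    + intros t. apply continuous_Cmult.
      * eapply continuous_circle; eauto. apply radii_bounds.
      * apply continuous_Cmult.
        -- apply continuous_Cmult; [apply continuous_Cconst|apply continuous_cis_lin].
        -- apply (continuous_RtoC (sine_block (n + m) l)), continuous_sine_block.
    + intros t. apply (continuous_plus (V := R_NormedModule)).
      * apply (continuous_scal_r (V := R_NormedModule) 12 (fun t =>
          circle_abs f (radii i) t * weight p t)), continuous_J.
      * apply (continuous_scal_r (V := R_NormedModule) 1 (fun t =>
          (-12) * (circle_abs f (radii i) t * weight q t) + D * circle_abs f (radii i) t)).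
        apply (continuous_plus (V := R_NormedModule)).
        -- apply (continuous_scal_r (V := R_NormedModule) (-12) (fun t =>
             circle_abs f (radii i) t * weight q t)), continuous_J.
        -- apply (continuous_scal_r (V := R_NormedModule) D (circle_abs f (radii i))), Hc.
    + intros t Ht. rewrite Cmod_mult. fold (circle_abs f (radii i) t).
      rewrite !Cmod_mult, Cmod_cis, Cmod_Ci, !Cmod_R, (Rabs_left (-2)) by lra.
      assert (P := sine_block_le_weights (n + m) l p q delta eta t Ht Hd He Hpq H1 H2).
      assert (Q := circle_abs_nonneg f (radii i) t). unfold D.
      apply Rle_trans with (circle_abs f (radii i) t * (12 * (weight p t - weight q t) + 2 / (INR
        (S (n + m)) * delta) + 4 * INR l * eta)).
      * apply Rmult_le_compat_l; lra.
      * right. ring.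
  - rewrite (RInt_lin (fun t => circle_abs f (radii i) t * weight p t)
      (fun t => -12 * (circle_abs f (radii i) t * weight q t) + D * circle_abs f (radii i) t)).
    + rewrite (RInt_lin (fun t => circle_abs f (radii i) t * weight q t) (circle_abs f (radii
        i))); [|apply continuous_J|exact Hc].
      fold (J p i). fold (J q i).
      assert (P := RInt_circle_abs_bounds a f A (radii i) Hp (radii_bounds i) (HA _ (radii_bounds
        i))).
      nra.
    + apply continuous_J.
    + intros t. apply (continuous_plus (V := R_NormedModule)).
      * apply (continuous_scal_r (V := R_NormedModule) (-12) (fun t =>
          circle_abs f (radii i) t * weight q t)), continuous_J.
      * apply (continuous_scal_r (V := R_NormedModule) D (circle_abs f (radii i))), Hc.
Qed.

(** By Bernoulli's inequality [1 - rho^k <= k (1 - rho)]. *)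
Lemma coef_block_radius n m l i :
  Cmod (csum (fun k => a (m + k)%nat / INR (n + (m + k) + 1)) l
      - csum (fun k => a (m + k)%nat * radii i ^ (m + k) / INR (n + (m + k) + 1)) l)%C
  <= INR l * (A * INR (m + l)) * (1 - radii i).
Proof.
  assert (R := radii_bounds i). assert (HA0 := mean_bound_nonneg).
  rewrite <- csum_minus.
  assert (G : forall l', (l' <= l)%nat ->
    Cmod (csum (fun k => a (m + k)%nat / INR (n + (m + k) + 1)
       - a (m + k)%nat * radii i ^ (m + k) / INR (n + (m + k) + 1)) l')%C
     <= INR l' * (A * INR (m + l)) * (1 - radii i)).
  { induction l' as [|l' IH]; intros Hl'.
    - simpl. rewrite Cmod_0. lra.
    - simpl csum. eapply Rle_trans; [apply Cmod_triangle|]. specialize (IH ltac:(lia)).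
      rewrite S_INR.
      assert (B : Cmod (a (m + l')%nat / INR (n + (m + l') + 1)
         - a (m + l')%nat * radii i ^ (m + l') / INR (n + (m + l') + 1))%C
         <= A * INR (m + l) * (1 - radii i)).
      { set (N := (n + (m + l') + 1)%nat).
        assert (HN : 1 <= INR N) by (apply (le_INR 1); unfold N; lia).
        assert (HNC : RtoC (INR N) <> RtoC 0) by (intros E; injection E; lra).
        replace (a (m + l')%nat / INR N - a (m + l')%nat * radii i ^ (m + l') / INR N)%C
        with (a (m + l')%nat * RtoC ((1 - radii i ^ (m + l')) * / INR N)%R)%C.
        2:{ rewrite RtoC_mult, RtoC_minus, RtoC_pow, RtoC_inv by lra. field. auto. }
        rewrite Cmod_mult, Cmod_R.
        assert (L := pow_ge_lin (radii i) (m + l') ltac:(lra)).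
        assert (U : radii i ^ (m + l') <= 1) by (rewrite <- (pow1 (m + l')); apply pow_incr; lra).
        assert (I : 0 < / INR N <= 1).
        { split; [apply Rinv_0_lt_compat; lra|]. rewrite <- Rinv_1. apply Rinv_le_contravar; lra. }
        rewrite Rabs_pos_eq by nra.
        assert (X : (1 - radii i ^ (m + l')) * / INR N <= INR (m + l) * (1 - radii i)).
        { assert (INR (m + l') <= INR (m + l)) by (apply le_INR; lia).
          assert (0 <= INR (m + l')) by apply pos_INR. nra. }
        assert (Y := coef_bound a f A (m + l') Hp HA).
        assert (Z := Cmod_ge_0 (a (m + l')%nat)).
        rewrite Rmult_assoc. apply Rmult_le_compat; auto. nra. }
      lra. }
  apply G. lia.
Qed.

(** The order of the choices matters: [p], hence [delta], depends on [eps] only and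
    fixes [m0]; then [eta], [q] and the radius may depend on the block. *)
Lemma coef_block_small n eps : 0 < eps -> exists m0, forall m l, (m0 <= m)%nat ->
  Cmod (csum (fun k => a (m + k)%nat / INR (n + (m + k) + 1)) l)%C <= eps.
Proof.
  intros Heps. assert (P := PI_RGT_0). assert (HA0 := mean_bound_nonneg).
  destruct (exists_persistent_level J (2 * PI * A) (eps / 4 * (2 * PI) / 12) J_bounds) as [p Hpp].
  { apply Rdiv_lt_0_compat; [|lra]. apply Rmult_lt_0_compat; lra. }
  (* Small enough for weight [p] to be at least [3/4] where [sin(t/2) <= delta]. *)
  set (delta := / (3 * (INR p + 1))).
  assert (Hp0 := pos_INR p).
  assert (Hd : 0 < delta) by (apply Rinv_0_lt_compat; lra).
  assert (Hd1 : delta * (3 * (INR p + 1)) = 1) by (apply Rinv_l; lra).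
  assert (Hdd : 3 * INR p * (delta * delta) <= 1) by nra.
  destruct (INR_archimed (eps * delta / 8) (A + 1)) as [m0 Hm0]; [nra|].
  exists m0. intros m l Hm. apply le_epsilon. intros e He.
  assert (Hl := pos_INR l).
  (* Small enough for the [l] terms of the block to be negligible where
     [sin(t/2) <= eta]. *)
  set (eta := eps / (16 * (INR l * A + 1))).
  assert (HlA : 0 <= INR l * A) by nra.
  assert (Heta : 0 < eta) by (apply Rdiv_lt_0_compat; lra).
  assert (Heta1 : eta * (16 * (INR l * A + 1)) = eps) by (unfold eta; field; lra).
  destruct (INR_archimed (eta * eta) 3) as [q0 Hq0]; [nra|].
  set (q := max p q0).
  assert (Hq : 3 <= INR q * (eta * eta)).
  { assert (INR q0 <= INR q) by (apply le_INR; unfold q; lia). nra. }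
  set (Bd := INR l * (A * INR (m + l))).
  assert (HBd : 0 <= Bd) by (unfold Bd; assert (Y := pos_INR (m + l)); apply Rmult_le_pos; nra).
  destruct (INR_archimed e Bd He) as [i0 Hi0].
  destruct (Hpp q (Nat.le_max_l _ _) i0) as [i [Hi Hji]].
  assert (B1 := coef_block_on_circle n m l p q delta eta i Hd Heta (Nat.le_max_l _ _) Hdd Hq).
  assert (B2 := coef_block_radius n m l i). fold Bd in B2.
  set (X := csum (fun k => a (m + k)%nat / INR (n + (m + k) + 1))%C l) in *.
  set (Y := csum (fun k => a (m + k)%nat * radii i ^ (m + k) / INR (n + (m + k) + 1))%C l) in *.
  assert (T1 : Cmod X <= Cmod (X - Y)%C + Cmod Y).
  { replace X with ((X - Y) + Y)%C at 1 by ring. apply Cmod_triangle. }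
  assert (T2 : Bd * (1 - radii i) <= e).
  { unfold radii. replace (1 - (1 - / (INR i + 1))) with (/ (INR i + 1)) by ring.
    assert (Hii := le_INR _ _ Hi). assert (Z := pos_INR i0).
    apply Rmult_le_reg_r with (INR i + 1); [lra|].
    rewrite Rmult_assoc, Rinv_l by lra. nra. }
  assert (T3 : 2 / (INR (S (n + m)) * delta) * A <= eps / 4).
  { assert (Hmm : INR m0 <= INR (S (n + m))) by (apply le_INR; lia).
    assert (HM : 0 < INR (S (n + m))) by (apply lt_0_INR; lia).
    assert (HMd : 0 < INR (S (n + m)) * delta) by nra.
    apply Rmult_le_reg_r with (INR (S (n + m)) * delta); auto.
    replace (2 / (INR (S (n + m)) * delta) * A * (INR (S (n + m)) * delta)) with (2 * A)
      by (field; lra).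
    assert (0 < eps * delta) by nra. nra. }
  assert (T4 : 4 * INR l * eta * A <= eps / 4) by nra.
  assert (T5 : Cmod Y <= eps / 4 + (2 / (INR (S (n + m)) * delta) + 4 * INR l * eta) * A).
  { apply Rmult_le_reg_l with (2 * PI); [lra|]. eapply Rle_trans; [exact B1|]. nra. }
  lra.
Qed.

Lemma hilbert_coef_conv n : exists b,
  is_Cseries (fun k => a k / INR (n + k + 1))%C b.
Proof.
  destruct (ex_series_Cauchy (K := R_AbsRing) (V := C_R_CompleteNormedModule)
     (fun k => a k / INR (n + k + 1))%C) as [b Hb].
  - intros eps.
    destruct (coef_block_small n (eps / 2)) as [m0 Hm0]; [assert (Q := cond_pos eps); lra|].
    exists m0. intros m m' Hm Hm'.
    assert (Q := cond_pos eps).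
    destruct (Nat.le_gt_cases m m') as [Hle|Hgt].
    + assert (E : sum_n_m (G := C_AbelianMonoid) (fun k => a k / INR (n + k + 1))%C m m'
        = csum (fun k => a (m + k)%nat / INR (n + (m + k) + 1))%C (S (m' - m))).
      { replace m' with (m + (m' - m))%nat at 1 by lia. apply sum_n_m_csum. }
      specialize (Hm0 m (S (m' - m)) Hm). rewrite <- E, Cmod_norm in Hm0.
      eapply Rle_lt_trans; [exact Hm0|lra].
    + rewrite sum_n_m_zero by exact Hgt. rewrite norm_zero. exact Q.
  - exists b. exact Hb.
Qed.
End Convergence.

(** * Exchanging integrals over a square *)

(** Joint continuity on the whole plane, in the form used by [continuous_comp_2]. *)
Definition cont2 (h : R -> R -> R) : Prop :=
  forall x y, continuous (fun p : R * R => h (fst p) (snd p)) (x, y).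

Lemma cont2_section h x y : cont2 h -> continuous (h x) y.
Proof.
  intros H. apply (continuous_comp_2 (fun _ => x) (fun y => y) h).
  - apply continuous_const.
  - apply continuous_id.
  - apply H.
Qed.

Lemma cont2_flip h : cont2 h -> cont2 (fun x y => h y x).
Proof.
  intros H x y. apply (continuous_comp_2 (U := prod_UniformSpace R_UniformSpace R_UniformSpace)
    (fun p : R * R => snd p) (fun p : R * R => fst p) h).
  - apply (continuous_snd (U := R_UniformSpace) (V := R_UniformSpace)).
  - apply (continuous_fst (U := R_UniformSpace) (V := R_UniformSpace)).
  - apply H.
Qed.

Lemma continuous_RInt_param_le h a b x : a <= b -> cont2 h -> continuous (fun x =>
  RInt (h x) a b) x.
Proof.
  intros Hb H. intros P [eps HP].
  assert (He : 0 < eps / (2 * (b - a + 1))) by (apply Rdiv_lt_0_compat; [apply cond_pos|lra]).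
  destruct (uniform_continuity_2d h (x - 1) (x + 1) a b) with (eps := mkposreal _ He) as [d Hd].
  { intros u v _ _. apply continuity_2d_pt_filterlim, H. }
  assert (Hm : 0 < Rmin d 1) by (apply Rmin_pos; [apply cond_pos|lra]).
  exists (mkposreal _ Hm). intros y Hy. apply HP.
  change (Rabs (y - x) < Rmin d 1) in Hy.
  assert (Hy1 := Rlt_le_trans _ _ _ Hy (Rmin_l _ _)).
  assert (Hy2 := Rlt_le_trans _ _ _ Hy (Rmin_r _ _)).
  change (Rabs (RInt (h y) a b - RInt (h x) a b) < eps).
  assert (Ex : forall z, ex_RInt (h z) a b) by (intros z; apply ex_RInt_cont; intros;
    now apply cont2_section).
  assert (E : RInt (h y) a b - RInt (h x) a b = RInt (fun t => h y t - h x t) a b).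
  { symmetry. apply (RInt_minus (V := R_CompleteNormedModule) (h y) (h x)); apply Ex. }
  rewrite E. eapply Rle_lt_trans.
  - apply (abs_RInt_le_const _ a b (eps / (2 * (b - a + 1)))); auto.
    + apply (ex_RInt_minus (V := R_NormedModule) (h y) (h x)); apply Ex.
    + intros t Ht. left. apply Rabs_def2 in Hy2. apply (Hd x t y t); try lra.
      rewrite Rminus_diag, Rabs_R0. apply cond_pos.
  - assert (Q := cond_pos eps).
    apply Rle_lt_trans with (eps / 2); [|lra].
    replace ((b - a) * (eps / (2 * (b - a + 1)))) with (eps / 2 * ((b - a) / (b - a + 1)))
      by (field; lra).
    rewrite <- (Rmult_1_r (eps / 2)) at 2. apply Rmult_le_compat_l; [lra|].
    apply Rmult_le_reg_r with (b - a + 1); [lra|]. unfold Rdiv.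
    rewrite Rmult_assoc, Rinv_l by lra. lra.
Qed.

Lemma continuous_RInt_param h a b x : cont2 h -> continuous (fun x => RInt (h x) a b) x.
Proof.
  intros H. destruct (Rle_dec a b) as [Hab|Hab].
  - now apply continuous_RInt_param_le.
  - apply (continuous_ext (fun x => opp (RInt (h x) b a))).
    { intros y. apply (opp_RInt_swap (V := R_CompleteNormedModule)), ex_RInt_cont.
      intros; now apply cont2_section. }
    apply (continuous_opp (V := R_NormedModule)), continuous_RInt_param_le; auto. lra.
Qed.

(** Both sides, with the upper limit of [t] replaced by [y], vanish at [y = 0] and
    have the same derivative in [y]. *)
Lemma RInt_swap h : cont2 h ->
  RInt (fun s => RInt (fun t => h s t) 0 (2 * PI)) 0 (2 * PI) =
  RInt (fun t => RInt (fun s => h s t) 0 (2 * PI)) 0 (2 * PI).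
Proof.
  intros H. assert (P := PI_RGT_0). assert (P2 : 0 <= 2 * PI) by lra.
  assert (Hin : forall s y, is_derive (fun y => RInt (h s) 0 y) y (h s y)).
  { intros s y. apply (is_derive_RInt (V := R_NormedModule) (h s) _ 0).
    - exists (mkposreal 1 Rlt_0_1). intros z _.
      apply (RInt_correct (V := R_CompleteNormedModule)), ex_RInt_cont. intros;
        now apply cont2_section.
    - now apply cont2_section. }
  assert (HF : forall y, is_derive (fun y => RInt (fun s => RInt (h s) 0 y) 0 (2 * PI)) y
       (RInt (fun s => h s y) 0 (2 * PI))).
  { intros y. apply (is_derive_RInt_periodic (fun y s => RInt (h s) 0 y) (fun y s =>
      h s y) y 1 Rlt_0_1).
    - intros u t _. apply Hin.
    - intros u t Hu. now apply continuous_RInt_param.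
    - intros t. apply cont2_flip, H. }
  assert (HG : forall y, is_derive (fun y => RInt (fun t => RInt (fun s => h s t) 0 (2 * PI)) 0 y) y
       (RInt (fun s => h s y) 0 (2 * PI))).
  { intros y.
    assert (Hc : forall t, continuous (fun t => RInt (fun s => h s t) 0 (2 * PI)) t).
    { intros t. apply (continuous_RInt_param (fun t s => h s t)); auto. now apply cont2_flip. }
    apply (is_derive_RInt (V := R_NormedModule) (fun t => RInt (fun s => h s t) 0 (2 * PI)) _ 0).
    - exists (mkposreal 1 Rlt_0_1). intros z _.
      apply (RInt_correct (V := R_CompleteNormedModule)), ex_RInt_cont, Hc.
    - apply Hc. }
  set (Phi := fun y => RInt (fun s => RInt (h s) 0 y) 0 (2 * PI)) in *.
  set (Psi := fun y => RInt (fun t => RInt (fun s => h s t) 0 (2 * PI)) 0 y) in *.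
  assert (E : Phi 0 - Psi 0 = Phi (2 * PI) - Psi (2 * PI)).
  { apply (eq_is_derive (V := R_NormedModule) (fun y => Phi y - Psi y)); [|lra].
    intros y _.
    assert (D := is_derive_minus (V := R_NormedModule) Phi Psi y _ _ (HF y) (HG y)).
    assert (Z : minus (RInt (fun s => h s y) 0 (2 * PI)) (RInt (fun s => h s y) 0 (2 * PI)) = 0)
      by apply Rminus_diag.
    exact (eq_ind _ (fun v => is_derive (fun y => Phi y - Psi y) y v) D _ Z). }
  change (Phi (2 * PI) = Psi (2 * PI)).
  assert (E1 : Phi 0 = 0).
  { unfold Phi. rewrite (RInt_ext _ (fun _ => 0)).
    - rewrite RInt_const. apply Rmult_0_r.
    - intros s _. apply (RInt_point (V := R_CompleteNormedModule)). }
  assert (E2 : Psi 0 = 0) by apply (RInt_point (V := R_CompleteNormedModule)).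
  lra.
Qed.

Lemma RInt_shift_periodic (k : R -> R) s : (forall t, continuous k t) ->
  (forall t, k (t + 2 * PI) = k t) ->
  RInt (fun t => k (t + s)) 0 (2 * PI) = RInt k 0 (2 * PI).
Proof.
  intros Hk Hper.
  assert (Ex : forall a b, ex_RInt k a b) by (intros; now apply ex_RInt_cont).
  assert (E : forall v a b, RInt (fun t => k (t + v)) a b = RInt k (a + v) (b + v)).
  { intros v a b. assert (E := RInt_comp_lin (V := R_CompleteNormedModule) k 1 v a b (Ex _ _)).
    rewrite !Rmult_1_l in E. rewrite <- E. apply RInt_ext. intros t _.
    change (k (t + v) = 1 * k (1 * t + v)). now rewrite !Rmult_1_l. }
  rewrite E, Rplus_0_l.
  assert (C1 := RInt_Chasles (V := R_CompleteNormedModule) k s (2 * PI) (2 * PI + s) (Ex _ _) (Ex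
    _ _)).
  assert (C2 := RInt_Chasles (V := R_CompleteNormedModule) k 0 s (2 * PI) (Ex _ _) (Ex _ _)).
  assert (C3 : RInt k (2 * PI) (2 * PI + s) = RInt k 0 s).
  { assert (E3 := E (2 * PI) 0 s). rewrite Rplus_0_l, (Rplus_comm s) in E3. rewrite <- E3.
    apply RInt_ext. intros t _. apply Hper. }
  rewrite <- C1, <- C2, C3. apply (plus_comm (G := R_AbelianMonoid)).
Qed.

(** * The mean of the modulus of the Cauchy kernel *)

(** The squared distance from 1 to the point [r e^{it}]. *)
Definition dist2 (r t : R) : R := 1 - 2 * r * cos t + r * r.

Lemma dist2_pos r t : Rabs r < 1 -> 0 < dist2 r t.
Proof.
  intros Hr. apply Rabs_def2 in Hr. unfold dist2. destruct (COS_bound t).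
  destruct (Rle_dec 0 r).
  - assert (0 < (1 - r) * (1 - r)) by nra. nra.
  - assert (0 < (1 + r) * (1 + r)) by nra. nra.
Qed.

Lemma dist2_Cmod (r t : R) : Cmod (1 - r * cis t)%C = sqrt (dist2 r t).
Proof.
  unfold Cmod, dist2, cis; simpl. f_equal.
  assert (S := sin2_cos2 t). unfold Rsqr in S. nra.
Qed.

Lemma continuous_dist2 (p : R * R) : continuous (fun p : R * R => dist2 (fst p) (snd p)) p.
Proof.
  apply (continuous_Rplus (fun p : R * R => 1 - 2 * fst p * cos (snd p)) (fun p : R * R =>
    fst p * fst p)).
  - apply (continuous_Rminus (fun _ => 1) (fun p : R * R => 2 * fst p * cos (snd p)));
      [apply continuous_const|].
    apply (continuous_Rmult (fun p : R * R => 2 * fst p)); [|apply continuous_cos_R2].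
    apply (continuous_Rmult (fun _ => 2)); [apply continuous_const|apply continuous_fst_R2].
  - apply continuous_Rmult; apply continuous_fst_R2.
Qed.

Lemma continuous_dist2_sec r t : continuous (dist2 r) t.
Proof. apply (ex_derive_continuous (V := R_NormedModule)). unfold dist2. auto_derive. exact I. Qed.

(** The Poisson kernel [(1 - r^2)/|1 - r e^{it}|^2] is harmonic: its derivative in
    [r] is the derivative in [t] of the periodic function [2 sin t/|1 - r e^{it}|^2],
    so its integral does not depend on [r]. *)
Lemma poisson_integral r : 0 <= r < 1 ->
  RInt (fun t => (1 - r * r) / dist2 r t) 0 (2 * PI) = 2 * PI.
Proof.
  intros Hr.
  set (dF := fun r t => (2 * cos t + 2 * (r * r) * cos t - 4 * r) / (dist2 r t * dist2 r t)).
  assert (Hd : forall x, 0 <= x < 1 ->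
    is_derive (fun r => RInt (fun t => (1 - r * r) / dist2 r t) 0 (2 * PI)) x 0).
  { intros x Hx.
    assert (Hu : forall u, Rabs (u - x) < 1 - x -> Rabs u < 1).
    { intros u Hu. apply Rabs_def2 in Hu. apply Rabs_def1; lra || idtac. }
    assert (E0 : RInt (dF x) 0 (2 * PI) = 0).
    { rewrite (is_RInt_unique _ _ _ (minus (2 * sin (2 * PI) / dist2 x (2 * PI)) (2 * sin 0 /
        dist2 x 0))).
      - rewrite sin_2PI, sin_0. unfold Rdiv. rewrite !Rmult_0_r, !Rmult_0_l. apply Rminus_diag.
      - apply (is_RInt_derive (V := R_CompleteNormedModule) (fun t => 2 * sin t / dist2 x t)).
        + intros t _. assert (D := dist2_pos x t (Hu x ltac:(rewrite Rminus_diag, Rabs_R0; lra))).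
          unfold dF, dist2 in *. auto_derive; [lra|].
          assert (S := sin2_cos2 t). unfold Rsqr in S.
          assert (S' : sin t * sin t = 1 - cos t * cos t) by lra.
          field_simplify_eq; [|lra].
          replace (sin t ^ 2) with (1 - cos t * cos t) by (rewrite <- S'; ring).
          ring.
        + intros t _. apply continuous_Rmult.
          * apply (ex_derive_continuous (V := R_NormedModule)). auto_derive. exact I.
          * assert (D := dist2_pos x t (Hu x ltac:(rewrite Rminus_diag, Rabs_R0; lra))).
            apply continuous_Rinv; [apply continuous_Rmult; apply continuous_dist2_sec|]. nra. }
    cut (is_derive (fun r => RInt (fun t => (1 - r * r) / dist2 r t) 0 (2 * PI)) x
           (RInt (dF x) 0 (2 * PI))).
    { rewrite E0. exact (fun D => D). }
    apply (is_derive_RInt_periodic (fun r t => (1 - r * r) / dist2 r t) dF x (1 - x)); [lra| | |].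
    - intros u t Hut. assert (D := dist2_pos u t (Hu u Hut)).
      unfold dF, dist2 in *. auto_derive; [lra|]. field. lra.
    - intros u t Hut. assert (D := dist2_pos u t (Hu u Hut)).
      apply continuous_Rmult; [apply continuous_const|].
      apply continuous_Rinv; [apply continuous_dist2_sec|lra].
    - intros t. assert (D := dist2_pos x t (Hu x ltac:(rewrite Rminus_diag, Rabs_R0; lra))).
      unfold dF. apply continuous_Rmult.
      + apply (continuous_Rminus (fun p : R * R =>
          2 * cos (snd p) + 2 * (fst p * fst p) * cos (snd p))
          (fun p : R * R => 4 * fst p)).
        * apply (continuous_Rplus (fun p : R * R => 2 * cos (snd p))).
          -- apply continuous_Rmult; [apply continuous_const|apply continuous_cos_R2].
          -- apply (continuous_Rmult (fun p : R * R => 2 * (fst p * fst p)));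
               [|apply continuous_cos_R2].
             apply (continuous_Rmult (fun _ => 2)); [apply continuous_const|].
             apply continuous_Rmult; apply continuous_fst_R2.
        * apply continuous_Rmult; [apply continuous_const|apply continuous_fst_R2].
      + apply continuous_Rinv; [apply continuous_Rmult; apply continuous_dist2|]. simpl. nra. }
  assert (E1 : RInt (fun t => (1 - 0 * 0) / dist2 0 t) 0 (2 * PI) = 2 * PI).
  { rewrite (RInt_ext _ (fun _ => 1)).
    - rewrite RInt_const. unfold scal; simpl; unfold mult; simpl. ring.
    - intros t _. unfold dist2. change (@eq R ((1 - 0 * 0) / (1 - 2 * 0 * cos t + 0 * 0)) 1);
        replace (1 - 2 * 0 * cos t + 0 * 0) with 1 by ring; field. }
  destruct (Req_dec r 0) as [->|Hr0]; [exact E1|].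
  etransitivity; [|exact E1]. symmetry.
  apply (eq_is_derive (V := R_NormedModule) (fun r => RInt (fun t =>
    (1 - r * r) / dist2 r t) 0 (2 * PI))); [|lra].
  intros x Hx. apply Hd. lra.
Qed.

Definition inv_dist (r t : R) : R := / sqrt (dist2 r t).

Lemma inv_dist_Cmod (r t : R) : inv_dist r t = / Cmod (1 - r * cis t)%C.
Proof. unfold inv_dist. now rewrite dist2_Cmod. Qed.

Lemma continuous_inv_dist r t : Rabs r < 1 -> continuous (inv_dist r) t.
Proof.
  intros Hr. assert (D := dist2_pos r t Hr). unfold inv_dist. apply continuous_Rinv.
  - apply (continuous_comp (dist2 r) sqrt); [apply continuous_dist2_sec|].
    apply continuous_sqrt.
  - assert (Q := sqrt_lt_R0 _ D). lra.
Qed.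

(** Both sides are [2 pi] at [r = 0].  The derivative of [1/|1 - r e^{it}|] in [r] is
    at most [1/|1 - r e^{it}|^2], whose integral is [2 pi/(1 - r^2)], while the right
    side has derivative [4 pi/(1 - r)]. *)
Lemma inv_dist_integral r : 0 <= r < 1 ->
  RInt (inv_dist r) 0 (2 * PI) <= 2 * PI * (1 - 2 * ln (1 - r)).
Proof.
  intros Hr. assert (P := PI_RGT_0).
  set (dk := fun r t => (cos t - r) / (dist2 r t * sqrt (dist2 r t))).
  assert (Hu : forall x u, 0 <= x < 1 -> Rabs (u - x) < 1 - x -> Rabs u < 1).
  { intros x u Hx Hu. apply Rabs_def2 in Hu. apply Rabs_def1; lra || idtac. }
  assert (Hself : forall x, 0 <= x < 1 -> Rabs x < 1) by (intros; apply Rabs_def1; lra).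
  assert (Hd : forall x, 0 <= x < 1 ->
    is_derive (fun r => RInt (inv_dist r) 0 (2 * PI)) x (RInt (dk x) 0 (2 * PI))).
  { intros x Hx. apply (is_derive_RInt_periodic inv_dist dk x (1 - x)); [lra| | |].
    - intros u t Hut. assert (D := dist2_pos u t (Hu x u Hx Hut)).
      assert (Q := sqrt_lt_R0 _ D). assert (Q2 := sqrt_sqrt _ (Rlt_le _ _ D)).
      unfold inv_dist, dk, dist2 in *. auto_derive.
      + split; [lra|split; [|exact I]].
        change (sqrt (1 - 2 * u * cos t + u * u) <> 0). lra.
      + change (1 + - (2 * u * cos t) + u * u) with (1 - 2 * u * cos t + u * u).
        set (d := 1 - 2 * u * cos t + u * u) in *.
        remember (sqrt d) as s eqn:Es. clearbody d. rewrite <- Q2. field. lra.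
    - intros u t Hut. apply continuous_inv_dist. now apply (Hu x).
    - intros t. assert (D := dist2_pos x t (Hself x Hx)). assert (Q := sqrt_lt_R0 _ D).
      unfold dk. apply continuous_Rmult.
      + apply continuous_Rminus; [apply continuous_cos_R2|apply continuous_fst_R2].
      + apply continuous_Rinv; [|simpl; nra]. apply continuous_Rmult; [apply continuous_dist2|].
        apply (continuous_comp (fun p : R * R => dist2 (fst p) (snd p)) sqrt);
          [apply continuous_dist2|].
        apply continuous_sqrt. }
  assert (Hb : forall x, 0 <= x < 1 -> RInt (dk x) 0 (2 * PI) <= 2 * PI * (2 / (1 - x))).
  { intros x Hx.
    assert (Hc : forall t, continuous (fun t => (1 - x * x) / dist2 x t) t).
    { intros t. assert (D := dist2_pos x t (Hself x Hx)).
      apply continuous_Rmult; [apply continuous_const|].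
      apply continuous_Rinv; [apply continuous_dist2_sec|lra]. }
    apply Rle_trans with (RInt (fun t =>
      / (1 - x * x) * ((1 - x * x) / dist2 x t) + 0 * ((1 - x * x) / dist2 x t)) 0 (2 * PI)).
    - apply RInt_cont_le.
      + intros t. assert (D := dist2_pos x t (Hself x Hx)). assert (Q := sqrt_lt_R0 _ D).
        unfold dk. apply continuous_Rmult.
        * apply continuous_Rminus; [apply continuous_cos|apply continuous_const].
        * apply continuous_Rinv; [|nra]. apply continuous_Rmult; [apply continuous_dist2_sec|].
          apply (continuous_comp (dist2 x) sqrt);
            [apply continuous_dist2_sec|apply continuous_sqrt].
      + intros t. apply continuous_Rplus; apply continuous_Rmult; auto; apply continuous_const.
      + intros t _. assert (D := dist2_pos x t (Hself x Hx)). assert (Q := sqrt_lt_R0 _ D).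
        assert (Q2 := sqrt_sqrt _ (Rlt_le _ _ D)).
        assert (X : cos t - x <= sqrt (dist2 x t)).
        { apply Rsqr_incr_0_var; [|lra]. unfold Rsqr. rewrite Q2. unfold dist2.
          assert (S := sin2_cos2 t). unfold Rsqr in S. nra. }
        replace (/ (1 - x * x) * ((1 - x * x) / dist2 x t) + 0 * ((1 - x * x) / dist2 x t))
          with (sqrt (dist2 x t) / (dist2 x t * sqrt (dist2 x t))) by (field; nra).
        unfold dk. apply Rmult_le_compat_r; [left; apply Rinv_0_lt_compat; nra|exact X].
    - rewrite RInt_lin, poisson_integral by auto.
      assert (I : 0 < / (1 - x)) by (apply Rinv_0_lt_compat; lra).
      assert (/ (1 - x * x) <= / (1 - x)) by (apply Rinv_le_contravar; nra).
      unfold Rdiv. nra. }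
  set (G := fun r => 2 * PI * (1 - 2 * ln (1 - r)) - RInt (inv_dist r) 0 (2 * PI)).
  assert (G0 : G 0 = 0).
  { unfold G. rewrite Rminus_0_r, ln_1. rewrite (RInt_ext _ (fun _ => 1)).
    - rewrite RInt_const. unfold scal; simpl; unfold mult; simpl. ring.
    - intros t _. unfold inv_dist, dist2. replace (1 - 2 * 0 * cos t + 0 * 0) with 1 by ring.
      rewrite sqrt_1. apply Rinv_1. }
  assert (Gd : forall x, 0 <= x < 1 -> is_derive G x (2 * PI * (2 / (1 - x)) - RInt (dk x) 0 (2 *
    PI))).
  { intros x Hx. unfold G.
    apply (is_derive_minus (V := R_NormedModule) (fun r => 2 * PI * (1 - 2 * ln (1 - r))));
      [|now apply Hd].
    auto_derive; [lra|]. field. lra. }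
  destruct (MVT_gen G 0 r (fun x => 2 * PI * (2 / (1 - x)) - RInt (dk x) 0 (2 * PI))) as [c [Hc
    Hm]].
  - intros x Hx. rewrite Rmin_left, Rmax_right in Hx by lra. apply Gd. lra.
  - intros x Hx. rewrite Rmin_left, Rmax_right in Hx by lra.
    apply continuity_pt_filterlim, (ex_derive_continuous (V := R_NormedModule)).
    eexists. apply Gd. lra.
  - rewrite Rmin_left, Rmax_right in Hc by lra. rewrite G0 in Hm.
    assert (Y := Hb c ltac:(lra)). unfold G in Hm. nra.
Qed.

(** * The sawtooth and Abel's theorem *)

Definition sawtooth (t : R) : R := PI - t.

Lemma continuous_sawtooth t : continuous sawtooth t.
Proof.
  apply (ex_derive_continuous (V := R_NormedModule)). unfold sawtooth. auto_derive. exact I.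
  
Qed.

Lemma CI_sawtooth j : CI (fun t => sawtooth t * cis (INR (S j) * t))%C = (Ci * RtoC (2 * PI / INR
  (S j)))%C.
Proof.
  set (m := INR (S j)). assert (Hm : m <> 0) by (apply not_0_INR; lia).
  assert (E := cis_2kPI (S j)). fold m in E. injection E as Ec Es.
  unfold CI, cis, sawtooth; simpl. unfold Ci, Cmult, RtoC; simpl.
  apply injective_projections; simpl.
  - rewrite (is_RInt_unique _ _ _ (minus ((PI - 2 * PI) * sin (m * (2 * PI)) / m - cos (m * (2 *
      PI)) / (m * m))
       ((PI - 0) * sin (m * 0) / m - cos (m * 0) / (m * m)))).
    + rewrite Ec, Es, !(Rmult_0_r m), sin_0, cos_0. unfold minus, plus, opp; simpl. field. auto.
    + apply (is_RInt_derive (V := R_CompleteNormedModule) (fun t =>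
        (PI - t) * sin (m * t) / m - cos (m * t) / (m * m))).
      * intros t _. auto_derive; auto. field. auto.
      * intros t _. apply (ex_derive_continuous (V := R_NormedModule)). auto_derive. auto.
  - rewrite (is_RInt_unique _ _ _ (minus (- (PI - 2 * PI) * cos (m * (2 * PI)) / m - sin (m * (2 *
      PI)) / (m * m))
       (- (PI - 0) * cos (m * 0) / m - sin (m * 0) / (m * m)))).
    + rewrite Ec, Es, !(Rmult_0_r m), sin_0, cos_0. unfold minus, plus, opp; simpl. field. auto.
    + apply (is_RInt_derive (V := R_CompleteNormedModule) (fun t =>
        - (PI - t) * cos (m * t) / m - sin (m * t) / (m * m))).
      * intros t _. auto_derive; auto. field. auto.
      * intros t _. apply (ex_derive_continuous (V := R_NormedModule)). auto_derive. auto.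
Qed.

(** [Abel] covers the case where the radius of convergence is exactly 1; if it is
    larger, the power series is continuous at 1. *)
Lemma abel_real (c : nat -> R) (s : R) : is_series c s -> (exists B, forall j : nat, Rabs (c j)
  <= B) ->
  filterlim (PSeries c) (at_left 1) (locally s).
Proof.
  intros Hs [B HB].
  assert (E1 : is_pseries c 1 s).
  { apply is_pseries_R. eapply is_series_ext_real; [|exact Hs]. intros k. rewrite pow1. ring. }
  assert (Es : PSeries c 1 = s) by now apply is_pseries_unique.
  assert (H1 : Rbar_le 1 (CV_radius c)).
  { apply (CV_radius_bounded c). exists B. intros n. rewrite pow1, Rmult_1_r. apply HB. }
  destruct (Rbar_le_lt_or_eq_dec _ _ H1) as [Hlt|Heq].
  - rewrite <- Es. eapply filterlim_filter_le_1; [apply filter_le_within|].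
    apply continuity_pt_filterlim, PSeries_continuity. rewrite Rabs_R1. exact Hlt.
  - rewrite <- Es. assert (A := Abel c). rewrite <- Heq in A. apply A; simpl; try lra; auto.
    now exists s.
Qed.

Lemma radii_lim : filterlim radii eventually (at_left 1).
Proof.
  intros P [eps HP].
  destruct (INR_archimed eps 1 (cond_pos eps)) as [i0 Hi0].
  exists i0. intros i Hi. assert (Hr := radii_bounds i). apply HP; [|lra].
  change (Rabs (radii i - 1) < eps). rewrite Rabs_left by lra.
  unfold radii. replace (- (1 - / (INR i + 1) - 1)) with (/ (INR i + 1)) by ring.
  assert (Q := le_INR _ _ Hi). assert (Z := pos_INR i0). assert (X := cond_pos eps).
  apply Rmult_lt_reg_r with (INR i + 1); [lra|]. rewrite Rinv_l by lra. nra.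
Qed.

Lemma abel_complex (c : nat -> C) (s : C) (sr : nat -> C) :
  is_Cseries c s ->
  (forall i, is_Cseries (fun k => c k * radii i ^ k)%C (sr i)) ->
  forall eps, 0 < eps -> exists i0, forall i, (i0 <= i)%nat -> Cmod (sr i - s)%C < eps.
Proof.
  intros Hs Hr eps Heps.
  destruct (is_Cseries_terms_bounded _ _ Hs) as [B HB].
  destruct (is_Cseries_ReIm _ _ Hs) as [S1 S2].
  assert (L1 : filterlim (fun i => PSeries (fun k =>
    Re (c k)) (radii i)) eventually (locally (Re s))).
  { eapply filterlim_comp; [apply radii_lim|]. apply abel_real; auto.
    exists B. intros j. eapply Rle_trans; [apply Cmod_fst_le|apply HB]. }
  assert (L2 : filterlim (fun i => PSeries (fun k =>
    Im (c k)) (radii i)) eventually (locally (Im s))).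
  { eapply filterlim_comp; [apply radii_lim|]. apply abel_real; auto.
    exists B. intros j. eapply Rle_trans; [apply Cmod_snd_le|apply HB]. }
  assert (E : forall i, Re (sr i) = PSeries (fun k => Re (c k)) (radii i)
    /\ Im (sr i) = PSeries (fun k => Im (c k)) (radii i)).
  { intros i. destruct (is_Cseries_ReIm _ _ (Hr i)) as [R1 R2].
    split; symmetry; apply is_pseries_unique, is_pseries_R;
      (eapply is_series_ext_real; [|eassumption]); intros k; cbv beta;
      rewrite <- RtoC_pow; unfold Re, Im, Cmult, RtoC; simpl; ring. }
  assert (He : 0 < eps / 2) by lra.
  destruct (L1 _ (locally_ball (Re s) (mkposreal _ He))) as [i1 H1].
  destruct (L2 _ (locally_ball (Im s) (mkposreal _ He))) as [i2 H2].
  exists (max i1 i2). intros i Hi.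
  specialize (H1 i ltac:(lia)). specialize (H2 i ltac:(lia)).
  destruct (E i) as [E1 E2]. rewrite <- E1 in H1. rewrite <- E2 in H2.
  change (Rabs (fst (sr i) - fst s) < eps / 2) in H1.
  change (Rabs (snd (sr i) - snd s) < eps / 2) in H2.
  eapply Rle_lt_trans; [apply Cmod_le_abs|]. simpl. unfold Rminus in H1, H2. lra.
Qed.

(** Comparison with a geometric series. *)
Lemma bounded_coef_pseries (c : nat -> C) B : (forall n, Cmod (c n) <= B) ->
  exists g, pseries_on 1 c g.
Proof.
  intros H. exists (fun z => CSeries (fun k => c k * z ^ k)%C). intros z Hz.
  assert (Hq := Cmod_ge_0 z).
  destruct (ex_Cseries_dominated (fun k => c k * z ^ k)%C (fun k => B * Cmod z ^ k)) as [l Hl].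
  - intros k. rewrite Cmod_mult, Cmod_pow. apply Rmult_le_compat_r; [now apply pow_le|apply H].
  - apply (ex_series_scal (V := R_NormedModule) B). apply ex_series_geom. rewrite Rabs_pos_eq; lra.
  - rewrite (CSeries_unique _ _ Hl). exact Hl.
Qed.

Lemma twoPI_nz : (2 * PI)%C <> RtoC 0.
Proof. rewrite <- RtoC_mult. assert (P := PI_RGT_0). intros E; injection E; lra. Qed.

Lemma Cmod_inv2PI : Cmod (/ (2 * PI))%C = / (2 * PI).
Proof.
  assert (P := PI_RGT_0). rewrite Cmod_inv by apply twoPI_nz.
  rewrite <- RtoC_mult, Cmod_R, Rabs_pos_eq; lra.
Qed.

Lemma Cmod_zcis z t : Cmod z < 1 -> Cmod (z * cis t)%C < 1.
Proof. intros H. rewrite Cmod_mult, Cmod_cis. lra. Qed.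

Lemma continuous_cauchy_ker z t : Cmod z < 1 -> continuous (fun t => / (1 - z * cis t))%C t.
Proof.
  intros H. apply continuous_Cinv.
  - apply continuous_Cminus; [apply continuous_Cconst|].
    apply continuous_Cmult; [apply continuous_Cconst|].
    apply (continuous_cis (fun t => t)), continuous_id.
  - apply one_minus_nz. now apply Cmod_zcis.
Qed.

(** The bounded function whose pairing with [e^{ikt}] is [2 pi/(j + k + 1)]. *)
Definition sawtooth_kernel (j : nat) (t : R) : C := (- Ci * (sawtooth t * cis (INR (S j) * t)))%C.

Lemma continuous_sawtooth_kernel j t : continuous (sawtooth_kernel j) t.
Proof.
  unfold sawtooth_kernel. apply continuous_Cmult; [apply continuous_Cconst|].
  apply continuous_Cmult; [|apply continuous_cis_lin].
  apply (continuous_RtoC sawtooth), continuous_sawtooth.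
Qed.

Lemma Cmod_sawtooth_kernel j t : 0 <= t <= 2 * PI -> Cmod (sawtooth_kernel j t) <= PI.
Proof.
  intros Ht. unfold sawtooth_kernel. rewrite !Cmod_mult, Cmod_opp, Cmod_Ci, Cmod_cis, Cmod_R.
  rewrite Rmult_1_r, Rmult_1_l. apply Rabs_le. unfold sawtooth. lra.
Qed.

(** * The bound on the image *)

Section Bound.
Variables (a b : nat -> C) (f : C -> C) (A : R).
Hypothesis Hp : pseries_on 1 a f.
Hypothesis HA : forall r, 0 <= r < 1 -> M1 r f <= A.
Hypothesis Hb : forall n, is_Cseries
  (fun k => a k / INR (n + k + 1))%C (b n).

(** The Abel mean [sum_k a_k rho^k/(n + k + 1)], written as an integral; see
    [abel_coef_series]. *)
Definition abel_coef (i n : nat) : C := (/ (2 * PI) * CI (fun t =>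
  f (radii i * cis t) * sawtooth_kernel n t))%C.

Lemma abel_coef_series i n : is_Cseries
  (fun k => a k / INR (n + k + 1) * radii i ^ k)%C (abel_coef i n).
Proof.
  unfold abel_coef. assert (P := circle_pairing a f 1 (radii i) (sawtooth_kernel n) Hp
    (radii_bounds i) (fun t => continuous_sawtooth_kernel n t)).
  apply (is_Cseries_scal (/ (2 * PI))%C) in P.
  eapply is_Cseries_ext; [|exact P]. intros k. cbv beta.
  assert (Hn : INR (S (n + k)) <> 0) by (apply not_0_INR; lia).
  assert (HnC : RtoC (INR (S (n + k))) <> RtoC 0) by (intros E; apply Hn; now injection E).
  replace (n + k + 1)%nat with (S (n + k)) by lia.
  rewrite (CI_ext _ (fun t => (- Ci) * (sawtooth t * cis (INR (S (n + k)) * t)))%C).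
  - rewrite CI_scal, CI_sawtooth.
    + rewrite RtoC_div, RtoC_mult by auto. assert (T := twoPI_nz).
      transitivity (- (Ci * Ci) * (a k / INR (S (n + k)) * radii i ^ k))%C.
      * field. repeat split; auto; intros E; apply T; rewrite E; ring.
      * replace (Ci * Ci)%C with (-(1))%C; [ring|].
        unfold Ci, Cmult, Copp, RtoC; simpl. apply injective_projections; simpl; ring.
    + intros t. apply continuous_Cmult; [|apply continuous_cis_lin].
      apply (continuous_RtoC sawtooth), continuous_sawtooth.
  - intros t. unfold sawtooth_kernel.
    replace (INR (S (n + k)) * t) with (INR k * t + INR (S n) * t) by (rewrite !S_INR, plus_INR;
      ring).
    rewrite cis_plus. ring.
Qed.

Lemma abel_coef_bound i n : Cmod (abel_coef i n) <= PI * A.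
Proof.
  assert (P := PI_RGT_0). unfold abel_coef. rewrite Cmod_mult, Cmod_inv2PI.
  assert (Hc : forall t, continuous (circle_abs f (radii i)) t)
    by (intros t; eapply continuous_circle_abs; eauto; apply radii_bounds).
  assert (B : Cmod (CI (fun t => f (radii i * cis t) * sawtooth_kernel n t)%C)
     <= RInt (fun t => PI * circle_abs f (radii i) t + 0 * circle_abs f (radii i) t) 0 (2 * PI)).
  { apply CI_norm.
    - intros t. apply continuous_Cmult; [|apply continuous_sawtooth_kernel].
      eapply continuous_circle; eauto. apply radii_bounds.
    - intros t. apply continuous_Rplus; apply continuous_Rmult; auto; apply continuous_const.
    - intros t Ht. rewrite Cmod_mult. fold (circle_abs f (radii i) t).
      assert (Q := Cmod_sawtooth_kernel n t Ht). assert (Z := circle_abs_nonneg f (radii i) t).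
      nra. }
  rewrite RInt_lin in B by assumption.
  assert (Y := RInt_circle_abs_bounds a f A (radii i) Hp (radii_bounds i) (HA _ (radii_bounds i))).
  apply Rmult_le_reg_l with (2 * PI); [lra|]. rewrite <- Rmult_assoc, Rinv_r by lra. nra.
Qed.

Lemma abel_coef_lim n eps : 0 < eps -> exists i0, forall i, (i0 <= i)%nat ->
  Cmod (abel_coef i n - b n)%C < eps.
Proof. apply (abel_complex _ _ _ (Hb n) (fun i => abel_coef_series i n)). Qed.

Lemma hilbert_coef_bound n : Cmod (b n) <= PI * A.
Proof.
  apply le_epsilon. intros eps Heps. destruct (abel_coef_lim n eps Heps) as [i Hi].
  specialize (Hi i (le_n _)). assert (Q := abel_coef_bound i n).
  replace (b n) with (abel_coef i n + - (abel_coef i n - b n))%C by ring.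
  eapply Rle_trans; [apply Cmod_triangle|]. rewrite Cmod_opp. lra.
Qed.

(** The image of [f(rho .)] under the Hilbert matrix, written as an integral; see
    [abel_image_series]. *)
Definition abel_image (i : nat) (z : C) : C :=
  (/ (2 * PI) * CI (fun t => / (1 - z * cis t) * (f (radii i * cis t) * sawtooth_kernel 0 t)))%C.

Lemma continuous_pairing_integrand i n t : continuous (fun t =>
  f (radii i * cis t) * sawtooth_kernel n t)%C t.
Proof.
  apply continuous_Cmult; [|apply continuous_sawtooth_kernel].
  eapply continuous_circle; eauto. apply radii_bounds.
Qed.

Lemma abel_image_series i : pseries_on 1 (abel_coef i) (abel_image i).
Proof.
  intros z Hz. unfold abel_image.
  assert (P := CI_series (fun k => z ^ k)%C cis (fun t => / (1 - z * cis t))%C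
     (fun t => f (radii i * cis t) * sawtooth_kernel 0 t)%C (ex_series_geom_abs z Hz)).
  assert (S1 : is_Cseries
    (fun k => z ^ k * CI (fun t => cis t ^ k * (f (radii i * cis t) * sawtooth_kernel 0 t)))%C
    (CI (fun t => / (1 - z * cis t) * (f (radii i * cis t) * sawtooth_kernel 0 t))%C)).
  { apply P.
    - intros t. apply (continuous_cis (fun t => t)), continuous_id.
    - intros t. rewrite Cmod_cis. lra.
    - intros t. now apply continuous_cauchy_ker.
    - intros t. apply continuous_pairing_integrand.
    - intros t. eapply is_Cseries_ext; [|apply is_Cseries_geom, Cmod_zcis, Hz].
      intros k. cbv beta. now rewrite Cpow_mult_l. }
  apply (is_Cseries_scal (/ (2 * PI))%C) in S1.
  eapply is_Cseries_ext; [|exact S1]. intros k. cbv beta. unfold abel_coef.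
  rewrite (CI_ext (fun t => cis t ^ k * (f (radii i * cis t) * sawtooth_kernel 0 t))%C (fun t =>
    f (radii i * cis t) * sawtooth_kernel k t)%C).
  - ring.
  - intros t. unfold sawtooth_kernel. rewrite cis_pow.
    replace (INR (S k) * t) with (INR k * t + INR 1 * t) by (rewrite !S_INR; simpl; ring).
    rewrite cis_plus. ring.
Qed.

Lemma abel_image_bound i r s : 0 <= r < 1 ->
  Cmod (abel_image i (r * cis s)%C) <= / 2 * RInt (fun t =>
    circle_abs f (radii i) t * inv_dist r (t + s)) 0 (2 * PI).
Proof.
  intros Hr. assert (P := PI_RGT_0). unfold abel_image. rewrite Cmod_mult, Cmod_inv2PI.
  assert (Hz : Cmod (r * cis s)%C < 1) by (rewrite Cmod_scal_cis; lra).
  assert (Hc : forall t, continuous (fun t => circle_abs f (radii i) t * inv_dist r (t + s)) t).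
  { intros t. apply continuous_Rmult.
    - eapply continuous_circle_abs; eauto. apply radii_bounds.
    - apply (continuous_comp (fun t => t + s) (inv_dist r)).
      + apply continuous_Rplus; [apply continuous_id|apply continuous_const].
      + apply continuous_inv_dist. rewrite Rabs_pos_eq; lra. }
  assert (B : Cmod (CI (fun t => / (1 - r * cis s * cis t) * (f (radii i * cis t) *
    sawtooth_kernel 0 t))%C)
     <= RInt (fun t => PI * (circle_abs f (radii i) t * inv_dist r (t + s)) + 0 * (circle_abs f
       (radii i) t * inv_dist r (t + s))) 0 (2 * PI)).
  { apply CI_norm.
    - intros t. apply continuous_Cmult; [now apply continuous_cauchy_ker|apply
        continuous_pairing_integrand].
    - intros t. apply continuous_Rplus; apply continuous_Rmult; auto; apply continuous_const.
    - intros t Ht. rewrite !Cmod_mult. fold (circle_abs f (radii i) t).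
      rewrite Cmod_inv by (apply one_minus_nz; now apply Cmod_zcis).
      assert (E : (r * cis s * cis t = r * cis (t + s))%C) by (rewrite cis_plus; ring).
      rewrite E, <- inv_dist_Cmod.
      assert (Q := Cmod_sawtooth_kernel 0 t Ht). assert (Z := circle_abs_nonneg f (radii i) t).
      assert (K0 : 0 <= inv_dist r (t + s)).
      { unfold inv_dist. left. apply Rinv_0_lt_compat, sqrt_lt_R0, dist2_pos. rewrite Rabs_pos_eq;
          lra. }
      assert (0 <= circle_abs f (radii i) t * inv_dist r (t + s)) by now apply Rmult_le_pos.
      assert (X : inv_dist r (t + s) * (circle_abs f (radii i) t * Cmod (sawtooth_kernel 0 t))
        <= inv_dist r (t + s) * (circle_abs f (radii i) t * PI)).
      { apply Rmult_le_compat_l; auto. apply Rmult_le_compat_l; auto. }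
      nra. }
  rewrite RInt_lin in B by assumption.
  apply Rmult_le_reg_l with (2 * PI); [lra|]. rewrite <- Rmult_assoc, Rinv_r by lra. nra.
Qed.

Lemma inv_dist_periodic r t : inv_dist r (t + 2 * PI) = inv_dist r t.
Proof.
  unfold inv_dist, dist2. replace (t + 2 * PI) with (t + 2 * INR 1 * PI) by (simpl; ring).
  now rewrite cos_period.
Qed.

(** After exchanging the integrals the inner one does not depend on [t], by
    periodicity. *)
Lemma mean_conv_bound i r : 0 <= r < 1 ->
  RInt (fun s => RInt (fun t => circle_abs f (radii i) t * inv_dist r (t + s)) 0 (2 * PI)) 0 (2 *
    PI)
  <= 2 * PI * A * (2 * PI * (1 - 2 * ln (1 - r))).
Proof.
  intros Hr. assert (P := PI_RGT_0).
  assert (Hr1 : Rabs r < 1) by (rewrite Rabs_pos_eq; lra).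
  assert (Hcc : forall t, continuous (circle_abs f (radii i)) t)
    by (intros t; eapply continuous_circle_abs; eauto; apply radii_bounds).
  assert (H2 : cont2 (fun s t => circle_abs f (radii i) t * inv_dist r (t + s))).
  { intros x y. apply continuous_Rmult.
    - apply (continuous_comp (fun p : R * R => snd p) (circle_abs f (radii i)));
        [apply continuous_snd_R2|apply Hcc].
    - apply (continuous_comp (fun p : R * R => snd p + fst p) (inv_dist r)).
      + apply continuous_Rplus; [apply continuous_snd_R2|apply continuous_fst_R2].
      + now apply continuous_inv_dist. }
  rewrite (RInt_swap _ H2).
  set (L := RInt (inv_dist r) 0 (2 * PI)).
  assert (HL := inv_dist_integral r Hr). fold L in HL.
  rewrite (RInt_ext _ (fun t => L * circle_abs f (radii i) t + 0 * circle_abs f (radii i) t)).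
  - rewrite RInt_lin by assumption.
    assert (Y := RInt_circle_abs_bounds a f A (radii i) Hp (radii_bounds i) (HA _ (radii_bounds
      i))).
    assert (Hln : ln (1 - r) <= 0).
    { rewrite <- ln_1. apply ln_le; lra. }
    set (I := RInt (circle_abs f (radii i)) 0 (2 * PI)) in *.
    assert (L * I <= 2 * PI * (1 - 2 * ln (1 - r)) * I) by (apply Rmult_le_compat_r; lra).
    assert (2 * PI * (1 - 2 * ln (1 - r)) * I <= 2 * PI * (1 - 2 * ln (1 - r)) * (2 * PI * A)).
    { apply Rmult_le_compat_l; [|lra]. apply Rmult_le_pos; lra. }
    lra.
  - intros t _.
    assert (E : RInt (fun s => circle_abs f (radii i) t * inv_dist r (t + s)) 0 (2 * PI) =
      circle_abs f (radii i) t * L).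
    { unfold L. rewrite <- (RInt_shift_periodic (inv_dist r) t).
      - rewrite <- (RInt_scal (V := R_CompleteNormedModule)).
        + apply RInt_ext. intros s _. now rewrite (Rplus_comm t s).
        + apply ex_RInt_cont. intros s. apply (continuous_comp (fun s => s + t) (inv_dist r)).
          * apply continuous_Rplus; [apply continuous_id|apply continuous_const].
          * now apply continuous_inv_dist.
      - intros s. now apply continuous_inv_dist.
      - intros s. apply inv_dist_periodic. }
    etransitivity; [exact E|]. change (circle_abs f (radii i) t * L = L * circle_abs f (radii i) t
      + 0 * circle_abs f (radii i) t). ring.
Qed.

Variable g : C -> C.
Hypothesis Hg : pseries_on 1 b g.

(** The coefficients of [g - abel_image i] are at most [2 pi A] and tend to 0 one by
    one, so on [|z| = r] finitely many of them matter. *)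
Lemma abel_image_approx r eps : 0 <= r < 1 -> 0 < eps ->
  exists i, forall s, Cmod (g (r * cis s)%C) <= Cmod (abel_image i (r * cis s)%C) + eps.
Proof.
  intros Hr Heps. assert (P := PI_RGT_0).
  assert (HA0 := mean_bound_nonneg a f A Hp HA).
  set (B := 2 * PI * A). assert (HB : 0 <= B) by (unfold B; nra).
  assert (Sg : is_series (fun k => B * r ^ k) (B * / (1 - r))).
  { apply (is_series_scal (V := R_NormedModule) B (fun k => r ^ k)). apply is_series_geom.
    rewrite Rabs_pos_eq; lra. }
  assert (He2 : 0 < eps / 2) by lra.
  destruct (proj1 (is_series_eps _ _) Sg _ He2) as [N HN]. specialize (HN N (le_n _)).
  assert (F : forall n, exists i0, forall i, (i0 <= i)%nat ->
     rsum (fun k => Cmod (b k - abel_coef i k)%C) n <= eps / 2).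
  { assert (F' : forall n d, 0 < d -> exists i0, forall i, (i0 <= i)%nat ->
     rsum (fun k => Cmod (b k - abel_coef i k)%C) n <= d).
    { induction n as [|n IH]; intros d Hd.
      - exists O. intros i _. simpl. lra.
      - destruct (IH (d / 2)) as [i1 H1]; [lra|].
        destruct (abel_coef_lim n (d / 2)) as [i2 H2]; [lra|].
        exists (max i1 i2). intros i Hi. simpl.
        specialize (H1 i ltac:(lia)). specialize (H2 i ltac:(lia)).
        replace (b n - abel_coef i n)%C with (- (abel_coef i n - b n))%C by ring.
        rewrite Cmod_opp. lra. }
    intros n. now apply F'. }
  destruct (F N) as [i Hi]. specialize (Hi i (le_n _)).
  exists i. intros s.
  assert (Hz : Cmod (r * cis s)%C < 1) by (rewrite Cmod_scal_cis; lra).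
  set (z := (r * cis s)%C) in *.
  assert (Hzr : Cmod z = r) by (apply Cmod_scal_cis; lra).
  assert (Sd := is_Cseries_minus _ _ _ _ (Hg z Hz) (abel_image_series i z Hz)).
  assert (Td : forall k, Cmod (b k * z ^ k - abel_coef i k * z ^ k)%C <= B * r ^ k).
  { intros k. replace (b k * z ^ k - abel_coef i k * z ^ k)%C with ((b k - abel_coef i k) * z ^
      k)%C by ring.
    rewrite Cmod_mult, Cmod_pow, Hzr. apply Rmult_le_compat_r; [apply pow_le; lra|].
    eapply Rle_trans; [apply Cmod_triangle|]. rewrite Cmod_opp.
    assert (X := hilbert_coef_bound k). assert (Y := abel_coef_bound i k). unfold B. lra. }
  assert (T := csum_tail _ _ _ _ N Td Sd Sg).
  assert (Fin : forall n, Cmod (csum (fun k => b k * z ^ k - abel_coef i k * z ^ k) n)%C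
      <= rsum (fun k => Cmod (b k - abel_coef i k)%C) n).
  { induction n as [|n IH]; simpl.
    - rewrite Cmod_0. lra.
    - eapply Rle_trans; [apply Cmod_triangle|]. apply Rplus_le_compat; [exact IH|].
      replace (b n * z ^ n - abel_coef i n * z ^ n)%C with ((b n - abel_coef i n) * z ^ n)%C
        by ring.
      rewrite Cmod_mult, Cmod_pow, Hzr.
      assert (r ^ n <= 1) by (rewrite <- (pow1 n); apply pow_incr; lra).
      assert (Q := Cmod_ge_0 (b n - abel_coef i n)%C). nra. }
  specialize (Fin N). apply Rabs_def2 in HN.
  set (cs := csum _ N) in *.
  replace (g z) with (abel_image i z + ((g z - abel_image i z - cs) + cs))%C by ring.
  eapply Rle_trans; [apply Cmod_triangle|]. apply Rplus_le_compat_l.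
  eapply Rle_trans; [apply Cmod_triangle|]. lra.
Qed.

Lemma M1_hilbert_bound r : 0 <= r < 1 -> M1 r g <= PI * A * (1 - 2 * ln (1 - r)).
Proof.
  intros Hr. apply le_epsilon. intros eps Heps. assert (P := PI_RGT_0).
  destruct (abel_image_approx r eps Hr Heps) as [i Hi].
  rewrite M1_circle_abs.
  apply Rmult_le_reg_l with (2 * PI); [lra|]. rewrite <- Rmult_assoc, Rinv_r, Rmult_1_l by lra.
  assert (Hr1 : Rabs r < 1) by (rewrite Rabs_pos_eq; lra).
  set (I := fun s => RInt (fun t => circle_abs f (radii i) t * inv_dist r (t + s)) 0 (2 * PI)).
  assert (HI : forall s, continuous I s).
  { intros s. apply (continuous_RInt_param (fun s t =>
      circle_abs f (radii i) t * inv_dist r (t + s))).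
    intros x y. apply continuous_Rmult.
    - apply (continuous_comp (fun p : R * R => snd p) (circle_abs f (radii i)));
        [apply continuous_snd_R2|].
      eapply continuous_circle_abs; eauto. apply radii_bounds.
    - apply (continuous_comp (fun p : R * R => snd p + fst p) (inv_dist r)).
      + apply continuous_Rplus; [apply continuous_snd_R2|apply continuous_fst_R2].
      + now apply continuous_inv_dist. }
  apply Rle_trans with (RInt (fun s => / 2 * I s + eps * 1) 0 (2 * PI)).
  - apply RInt_cont_le.
    + intros s. eapply continuous_circle_abs; eauto.
    + intros s. apply continuous_Rplus; [|apply continuous_const].
      apply continuous_Rmult; [apply continuous_const|apply HI].
    + intros s _. unfold circle_abs at 1. eapply Rle_trans; [apply Hi|].
      assert (Q := abel_image_bound i r s Hr). fold (I s) in Q. lra.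
  - rewrite (RInt_lin I (fun _ => 1)); [|exact HI|intros; apply continuous_const].
    rewrite RInt_const. assert (Q := mean_conv_bound i r Hr). fold I in Q.
    unfold scal; simpl; unfold mult; simpl. nra.
Qed.
End Bound.

(** * The operator norm *)

Lemma log_weight r : 0 <= r < 1 -> ln (exp 1 / (1 - r) ^ 2) = 1 - 2 * ln (1 - r).
Proof.
  intros Hr. assert (H0 : 0 < 1 - r) by lra.
  unfold Rdiv. rewrite ln_mult; [|apply exp_pos|apply Rinv_0_lt_compat, pow_lt, H0].
  rewrite ln_exp, ln_Rinv by now apply pow_lt. rewrite ln_pow by exact H0. simpl. ring.
Qed.

Lemma H1_norm_bound f A r : H1_norm f = Finite A -> 0 <= r < 1 -> M1 r f <= A.
Proof.
  intros E Hr. unfold H1_norm in E.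
  assert (L := Lub_Rbar_correct (fun x => exists r, 0 <= r < 1 /\ x = M1 r f)). rewrite E in L.
  apply (proj1 L). now exists r.
Qed.

Lemma H1_norm_finite f : H1 f -> exists A, H1_norm f = Finite A.
Proof.
  intros [_ H]. unfold H1_norm in *.
  assert (L := Lub_Rbar_correct (fun x => exists r, 0 <= r < 1 /\ x = M1 r f)).
  destruct (Lub_Rbar _) as [A| |].
  - now exists A.
  - contradiction.
  - exfalso. apply (proj1 L (M1 0 f)). exists 0. split; [lra|reflexivity].
Qed.

(** This is where [pi] is replaced by [2 pi log 2], using [log 2 > 1/2]. *)
Lemma H1log_norm_le a b f g A : pseries_on 1 a f -> (forall r, 0 <= r < 1 -> M1 r f <= A) ->
  (forall n, is_Cseries (fun k => a k / INR (n + k + 1))%C (b n)) ->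
  pseries_on 1 b g -> Rbar_le (H1log_norm g) (Finite (2 * PI * ln 2 * A)).
Proof.
  intros Hp HA Hb Hg. unfold H1log_norm.
  apply (proj2 (Lub_Rbar_correct _)). intros x [r [Hr ->]].
  change (/ ln (exp 1 / (1 - r) ^ 2) * M1 r g <= 2 * PI * ln 2 * A).
  assert (B := M1_hilbert_bound a b f A Hp HA Hb g Hg r Hr).
  rewrite log_weight by exact Hr.
  assert (Hln : ln (1 - r) <= 0) by (rewrite <- ln_1; apply ln_le; lra).
  assert (P := PI_RGT_0). assert (L2 := ln_lt_2).
  assert (HA0 := mean_bound_nonneg a f A Hp HA).
  set (W := 1 - 2 * ln (1 - r)) in *. assert (HW : 0 < W) by (unfold W; lra).
  apply Rmult_le_reg_l with W; [exact HW|].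
  rewrite <- Rmult_assoc, Rinv_r, Rmult_1_l by lra.
  assert (0 <= PI * A * W) by (apply Rmult_le_pos; [nra|lra]).
  apply Rle_trans with (PI * A * W); [exact B|]. nra.
Qed.

Theorem theorem4p1 :
  (forall f : C -> C, H1 f -> exists g : C -> C, hilbert f g /\ H1log g) /\
  Rbar_le hilbert_norm_H1_H1log (Finite (2 * PI * ln 2)).
Proof.
  split.
  - intros f Hf. destruct (H1_norm_finite f Hf) as [A EA].
    assert (HA := fun r => H1_norm_bound f A r EA).
    destruct (analytic_pseries f (proj1 Hf)) as [a Ha].
    set (b := fun n => CSeries (fun k => a k / INR (n + k + 1))%C).
    assert (Hb : forall n, is_Cseries (fun k => a k / INR (n + k + 1))%C (b n)).
    { intros n. destruct (hilbert_coef_conv a f A Ha HA n) as [l Hl].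
      unfold b. rewrite (CSeries_unique _ _ Hl). exact Hl. }
    destruct (bounded_coef_pseries b (PI * A) (hilbert_coef_bound a b f A Ha HA Hb)) as [g Hg].
    assert (Hgan := pseries_on_analytic b g Hg).
    exists g. split.
    + exists a, b. split; [|split; [exact Hb|split; [|exact Hgan]]].
      * intros z Hz. apply is_pseries_Cseries. now apply Ha.
      * intros z Hz. apply is_pseries_Cseries. now apply Hg.
    + split; [exact Hgan|].
      eapply Rbar_le_lt_trans; [apply (H1log_norm_le a b f g A); auto|]. exact I.
  - unfold hilbert_norm_H1_H1log. apply (proj2 (proj2_sig (Rbar_ex_lub _))).
    intros q [f [g [Hf [Hnz [Hh ->]]]]].
    destruct (H1_norm_finite f Hf) as [A EA].
    assert (HA := fun r => H1_norm_bound f A r EA).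
    destruct Hh as [a [b [Ha [Hb [Hg _]]]]].
    assert (Ha' : pseries_on 1 a f) by (intros z Hz; apply is_pseries_Cseries; now apply Ha).
    assert (Hg' : pseries_on 1 b g) by (intros z Hz; apply is_pseries_Cseries; now apply Hg).
    assert (HA0 : 0 < A).
    { destruct (mean_bound_nonneg a f A Ha' HA) as [|E]; auto. exfalso.
      destruct Hnz as [z [Hz Hfz]]. apply Hfz.
      eapply is_Cseries_unique; [apply Ha', Hz|].
      replace (RtoC 0) with (a O * z ^ 0)%C.
      - apply (is_Cseries_single (fun k => a k * z ^ k)%C). intros k _.
        rewrite (Cmod_eq_0 (a k)); [ring|].
        apply Rle_antisym; [|apply Cmod_ge_0]. rewrite E. apply (coef_bound a f A k Ha' HA).
      - rewrite (Cmod_eq_0 (a O)); [ring|].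
        apply Rle_antisym; [|apply Cmod_ge_0]. rewrite E. apply (coef_bound a f A O Ha' HA). }
    assert (L := H1log_norm_le a b f g A Ha' HA Hb Hg').
    rewrite EA. destruct (H1log_norm g) as [x| |]; [|contradiction|].
    + simpl in *. apply Rmult_le_reg_r with A; [exact HA0|].
      rewrite Rmult_assoc, Rinv_l, Rmult_1_r by lra. exact L.
    + assert (I : 0 < / A) by now apply Rinv_0_lt_compat.
      simpl. destruct (Rle_dec 0 (/ A)) as [H|H]; [|lra].
      destruct (Rle_lt_or_eq_dec 0 (/ A) H); [exact Logic.I|lra].
Qed.
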